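(* Let $G$ be a profinite group, $H$ an open subgroup of $G$, $S$ a truncation set for $H$, $K$ an open subgroup of $H$, and $S|_K=\{U\in S\mid U\le K\}$. There is a Verschiebung operator $$V^H_K:W^{S|_K}_{K\le G}(R;M)\to W^S_{H\le G}(R;M),$$ natural in $(R;M)\in\mathrm{Mod}$. It is the unique natural transformation (of functors $\mathrm{Mod}\to\mathrm{Ab}_{\mathrm{Haus}}$) such that $w\circ V^H_K=\tilde V^H_K\circ w$, where $w$ denotes the ghost maps out of the Witt vectors and $\tilde V^H_K:\mathrm{gh}^{S|_K}_{K\le G}(R;M)\to\mathrm{gh}^S_{H\le G}(R;M)$ is the composite $$\Big(\prod_{U\in S|_K}M^{\otimes_R G/U}\Big)^K\hookrightarrow\Big(\prod_{U\in S}M^{\otimes_R G/U}\Big)^K\xrightarrow{\ \mathrm{tr}^H_K\ }\Big(\prod_{U\in S}M^{\otimes_R G/U}\Big)^H$$ of extension by zero and the transfer $\mathrm{tr}^H_K(x)=\sum_{aK\in H/K}a\cdot x$.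
   Context: Conventions. All rings are commutative. $V\le_o G$ means $V$ is an open subgroup. For an $R$-module $M$ and a finite set $X$, $M^{\otimes_R X}$ is the tensor power over $R$ indexed by $X$, regarded as a discrete group. $\mathrm{Ab}_{\mathrm{Haus}}$ is the category of Hausdorff topological abelian groups. $\mathrm{Mod}$ is the category of pairs $(R;M)$ with $R$ a ring and $M$ an $R$-module; a morphism $(R;M)\to(R';M')$ is a ring homomorphism $\alpha:R\to R'$ together with an $R$-linear map $M\to\alpha^*M'$. The forgetful functor $U:\mathrm{Mod}\to\mathrm{Set}\times\mathrm{Set}$ has left adjoint $F(X,Y)=(\mathbb{Z}[X];\mathbb{Z}[X](Y))$; objects isomorphic to some $F(X,Y)$ are called free. Tensor powers. For $V\le_o G$, $g\in G$, the isomorphism $g\cdot(-):M^{\otimes_R G/V}\to M^{\otimes_R G/gVg^{-1}}$ sends $\bigotimes_{aV}m_{aV}$ to the tensor whose factor at the coset $a(gVg^{-1})$ is $m_{agV}$. These maps give an $H$-action on $\prod_{U\in S}M^{\otimes_R G/U}$. For $U\le_o V\le_o G$ and coset representatives $\{g_i\}$ of $G/V$, $f_{G/V}:M^{\otimes_R G/V\times V/U}\to M^{\otimes_R G/U}$ is induced by the bijection $(g_iV,sU)\mapsto g_isU$. For $n\in M^{\otimes_R G/V}$, $n^{\otimes_R V/U}\in M^{\otimes_R G/V\times V/U}$ is its tensor power indexed by $V/U$. Ghost map. A truncation set $S$ for $H$ is a set of open subgroups of $H$ closed under $H$-conjugation and upwards closed among open subgroups of $H$. Let $\underline{S}\subseteq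 S$ contain one representative of each $H$-conjugacy class in $S$, and fix coset representatives for $G/V$ for each $V\in\underline{S}$. Put $\mathrm{gh}^S_{H\le G}(R;M)=\big(\prod_{U\in S}M^{\otimes_R G/U}\big)^H$ (subspace of the product topology). The ghost map $w:\prod_{V\in\underline{S}}M^{\otimes_R G/V}\to\mathrm{gh}^S_{H\le G}(R;M)$ has components $$w_U(n)=\sum_{V\in\underline{S}}\ \sum_{hV\in (H/V)^U}h\cdot f_{G/V}\big(n_V^{\otimes_R V/h^{-1}Uh}\big),\qquad (H/V)^U=\{hV: h^{-1}Uh\le V\}.$$ Witt vectors. For $(T;Q)$ free, $\mathrm{im}(w)$ is a closed subgroup of $\mathrm{gh}^S_{H\le G}(T;Q)$, independent of the choices and functorial; put $W^S_{H\le G}(T;Q)=\mathrm{im}(w)$. For general $(R;M)$, $W^S_{H\le G}(R;M)$ is the coequaliser in $\mathrm{Ab}_{\mathrm{Haus}}$ (quotient by the closure of the subgroup of differences) of $W^S_{H\le G}(FUFU(R;M))\rightrightarrows W^S_{H\le G}(FU(R;M))$ induced by the canonical presentation $FUFU(R;M)\rightrightarrows FU(R;M)\to(R;M)$. The inclusions $\mathrm{im}(w)\subseteq\mathrm{gh}$ for free objects extend uniquely to a natural continuous homomorphism $w:W^S_{H\le G}(R;M)\to\mathrm{gh}^S_{H\le G}(R;M)$, also called the ghost map. *)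

(* Defs.v *)
From HB Require Import structures.
From mathcomp Require Import all_boot all_algebra finmap.
From mathcomp Require Import all_classical topology.
From mathcomp Require Import monalg.

Set Implicit Arguments.
Unset Strict Implicit.
Unset Printing Implicit Defensive.

Import GRing.Theory.
Local Open Scope classical_set_scope.
Local Open Scope quotient_scope.
Local Open Scope ring_scope.

HB.mixin Record isTopologicalGroup G of Topological G & Group G := {
  mulg_continuous : continuous (fun xy : G * G => (xy.1 * xy.2)%g);
  invg_continuous : continuous (fun x : G => (x^-1)%g)
}.

#[short(type="topologicalGroupType")]
HB.structure Definition TopologicalGroup :=
  {G of isTopologicalGroup G & Topological G & Group G}.

Definition profinite (G : topologicalGroupType) : Prop :=
  [/\ compact [set: G], hausdorff_space G & totally_disconnected [set: G]].

Section OpenSubgroups.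
Variable G : topologicalGroupType.
Implicit Types (g x y : G).

Record openSubgroup := OpenSubgroup {
  osub :> set G;
  osub1 : osub 1%g;
  osubD : forall x y, osub x -> osub y -> osub (x^-1 * y)%g;
  osub_open : open osub
}.

HB.instance Definition _ := gen_eqMixin openSubgroup.
HB.instance Definition _ := gen_choiceMixin openSubgroup.

Lemma osubV (U : openSubgroup) x : osub U x -> osub U (x^-1)%g.
Proof. by move=> Ux; rewrite -[(x^-1)%g]mulg1; apply: osubD => //; apply: osub1. Qed.

Lemma osubM (U : openSubgroup) x y : osub U x -> osub U y -> osub U (x * y)%g.
Proof. by move=> /osubV Ux Uy; rewrite -[x]invgK; apply: osubD. Qed.

Lemma conjg_continuous g : continuous (fun x : G => (x ^ g)%g).
Proof.
move=> x; rewrite /conjg.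
pose c (h : G) := fun _ : G => h.
have L (h : G) : {for x, continuous (fun y : G => (h * y)%g)}.
  apply: (@continuous_comp _ _ _ (fun y : G => (h, y)) (fun z => (z.1 * z.2)%g)).
    by apply: cvg_pair; [exact: cvg_cst | exact: cvg_id].
  exact: mulg_continuous.
apply: (@continuous_comp _ _ _ (fun y : G => (y * g)%g) (fun y => (g^-1 * y)%g)).
  apply: (@continuous_comp _ _ _ (fun y : G => (y, g)) (fun z => (z.1 * z.2)%g)).
    by apply: cvg_pair; [exact: cvg_id | exact: cvg_cst].
  exact: mulg_continuous.
apply: (@continuous_comp _ _ _ (fun y : G => (g^-1%g, y)) (fun z => (z.1 * z.2)%g)).
  by apply: cvg_pair; [exact: cvg_cst | exact: cvg_id].
exact: mulg_continuous.
Qed.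

(* [conjos g U] is g U g^-1; recall that x ^ g is g^-1 * x * g *)
Program Definition conjos g (U : openSubgroup) : openSubgroup :=
  @OpenSubgroup [set x | osub U (x ^ g)%g] _ _ _.
Next Obligation. by move=> g U; rewrite /= conj1g; apply: osub1. Qed.
Next Obligation.
by move=> g U x y /= Ux Uy; rewrite conjMg conjVg; apply: osubD.
Qed.
Next Obligation.
move=> g U /=; apply: (@open_comp _ _ (fun x : G => (x ^ g)%g) U).
  by move=> x _; apply: conjg_continuous.
exact: osub_open.
Qed.

Definition truncation_set (H : openSubgroup) (S : set openSubgroup) : Prop :=
  [/\ forall U, S U -> U `<=` H,
      forall h U, osub H h -> S U -> S (conjos h U) &
      forall U V : openSubgroup, S U -> U `<=` V -> V `<=` H -> S V].

Definition restr_trunc (S : set openSubgroup) (K : openSubgroup) :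
  set openSubgroup := [set U | S U /\ U `<=` K].

(* For a map [f] into [G], the quotient of its domain by the relation
   f x U = f y U; [cosets id U] is G/U and, for U <= V, [cosets set_val U]
   with [set_val : V -> G] is V/U. *)
Section Cosets.
Variables (T : choiceType) (f : T -> G) (U : openSubgroup).

Definition lcoset_eq (x y : T) : bool := `[< osub U ((f x)^-1 * f y)%g >].

Lemma lcoset_eq_equiv : equiv_class_of lcoset_eq.
Proof.
split=> [x|x y|y x z].
- by apply/asboolP; rewrite mulVg; apply: osub1.
- by apply/asboolP/asboolP => /osubV; rewrite invgM invgK.
- move=> /asboolP Uxy /asboolP Uyz; apply/asboolP.
  by have := osubM Uxy Uyz; rewrite mulgA mulgK.
Qed.

Canonical lcoset_equiv := EquivRelPack lcoset_eq_equiv.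
Canonical lcoset_encModRel := defaultEncModRel lcoset_eq.

Definition lcosets := {eq_quot lcoset_eq}.
HB.instance Definition _ := Choice.on lcosets.
HB.instance Definition _ : EqQuotient T lcoset_eq lcosets := EqQuotient.on lcosets.

Lemma lcosetsP (x y : T) :
  reflect (\pi_lcosets x = \pi_lcosets y) `[< osub U ((f x)^-1 * f y)%g >].
Proof. by apply: (iffP idP) => [?|/eqmodP//]; apply/eqmodP. Qed.

End Cosets.

Definition cosets (U : openSubgroup) := lcosets (@id G) U.
Definition relcosets (V U : openSubgroup) := lcosets (@set_val G V) U.

End OpenSubgroups.

Section ZSpan.
Variables (V : zmodType) (B : set V).

(* the subgroup generated by [B] *)
Definition zspan : {pred V} := fun z =>
  `[< forall P : {pred V}, zmod_closed P -> (forall b, B b -> b \in P) ->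
      z \in P >].

Lemma zspan_closed : zmod_closed zspan.
Proof.
split=> [|x y /asboolP Bx /asboolP By]; apply/asboolP => P Pz BP.
  by case: Pz.
by case: (Pz) => _; apply; [apply: Bx | apply: By].
Qed.

HB.instance Definition _ := GRing.isZmodClosed.Build V zspan zspan_closed.

Lemma mem_zspan b : B b -> b \in zspan.
Proof. by move=> Bb; apply/asboolP => P _; apply. Qed.

End ZSpan.

(* The tensor power of [M] indexed by [X]: the free [R]-module on [X -> M]
   modulo multilinearity. It is the usual tensor power when [X] is finite.
   [<< c *g m >>] is the generator m with coefficient c; since the relations
   are imposed for every c, the subgroup they span is an [R]-submodule. *)
Section TensorPower.
Variables (R : comPzRingType) (M : lmodType R) (X : choiceType).

Definition multilin_rels : set {malg R[X -> M]} :=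
  [set z | exists (c : R) (m : X -> M) (i : X) (a : R) (x y : M),
    z = << c *g dfwith m i (a *: x + y) >>
        - (<< (c * a) *g dfwith m i x >> + << c *g dfwith m i y >>)].

Definition tens := Quotient.quot (zspan multilin_rels).
HB.instance Definition _ := GRing.Zmodule.on tens.
HB.instance Definition _ :=
  @EqQuotient.on tens.

Definition mcoeffmul (a : R) (z : {malg R[X -> M]}) : {malg R[X -> M]} :=
  \sum_(m <- msupp z) << (a * z@_m) *g m >>.

Lemma mcoeffmulE a z m : (mcoeffmul a z)@_m = a * z@_m.
Proof.
rewrite {2}[z]monalgE !raddf_sum mulr_sumr.
by apply/eq_bigr=> /= i _; rewrite !mcoeffU mulrnAr.
Qed.

Lemma mcoeffmulB a : {morph mcoeffmul a : x y / x - y}.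
Proof.
by move=> x y; apply/malgP => m; rewrite mcoeffB !mcoeffmulE mcoeffB mulrBr.
Qed.

Lemma mcoeffmul_span a z :
  z \in zspan multilin_rels -> mcoeffmul a z \in zspan multilin_rels.
Proof.
have aS x y : mcoeffmul a x \in zspan multilin_rels ->
    mcoeffmul a y \in zspan multilin_rels ->
    mcoeffmul a (x - y) \in zspan multilin_rels.
  by move=> Sx Sy; rewrite mcoeffmulB; exact: rpredB.
have a0 : mcoeffmul a 0 \in zspan multilin_rels.
  by rewrite /mcoeffmul msupp0 big_nil; exact: rpred0.
move=> /asboolP/(_ (fun z => mcoeffmul a z \in zspan multilin_rels)); apply.
  by split.
move=> _ [c [m [i [b [x [y ->]]]]]]; apply: mem_zspan.
exists (a * c), m, i, b, x, y; apply/malgP => k.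
rewrite mcoeffmulE !mcoeffB !mcoeffD !mcoeffU mulrBr mulrDr -!mulrnAr -!mulrA.
by rewrite !mulrnAr.
Qed.

Definition tscale (a : R) (t : tens) : tens := \pi_tens (mcoeffmul a (repr t)).

Lemma pi_tscale a z : tscale a (\pi_tens z) = \pi_tens (mcoeffmul a z).
Proof.
apply/eqP; rewrite /tscale -Quotient.idealrBE -mcoeffmulB; apply: mcoeffmul_span.
by rewrite Quotient.idealrBE reprK.
Qed.


Let tpiD (x y : {malg R[X -> M]}) :
  \pi_tens x + \pi_tens y = \pi_tens (x + y).
Proof. by rewrite [RHS]raddfD. Qed.

Lemma tscaleA a b t : tscale a (tscale b t) = tscale (a * b) t.
Proof.
rewrite -[t]reprK (pi_tscale b) !pi_tscale; congr (\pi_tens _).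
by apply/malgP => m; rewrite !mcoeffmulE mulrA.
Qed.

Lemma tscale1 : left_id 1 tscale.
Proof.
move=> t; rewrite -[t]reprK pi_tscale; congr (\pi_tens _); apply/malgP => m.
by rewrite mcoeffmulE mul1r.
Qed.

Lemma tscaleDr : right_distributive tscale +%R.
Proof.
move=> a t u; rewrite -[t]reprK -[u]reprK tpiD !pi_tscale tpiD.
by congr (\pi_tens _); apply/malgP => m; rewrite !(mcoeffD, mcoeffmulE) mulrDr.
Qed.

Lemma tscaleDl t : {morph tscale^~ t : a b / a + b}.
Proof.
move=> a b; rewrite -[t]reprK !pi_tscale tpiD.
by congr (\pi_tens _); apply/malgP => m; rewrite !(mcoeffD, mcoeffmulE) mulrDl.
Qed.

HB.instance Definition _ :=
  GRing.Zmodule_isLmodule.Build R tens tscaleA tscale1 tscaleDr tscaleDl.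

Lemma scale_tpi a (z : {malg R[X -> M]}) :
  a *: (\pi_tens z : tens) = \pi_tens (mcoeffmul a z).
Proof. exact: pi_tscale. Qed.

(* the pure tensor (x)_(i in X) m i *)
Definition tpure (m : X -> M) : tens := \pi_tens << 1 *g m >>.

Lemma tpure_lin m i a (x y : M) :
  tpure (dfwith m i (a *: x + y)) =
  a *: tpure (dfwith m i x) + tpure (dfwith m i y).
Proof.
rewrite /tpure scale_tpi tpiD; apply/eqP; rewrite -Quotient.idealrBE.
apply: mem_zspan; exists 1, m, i, a, x, y; congr (_ - (_ + _)); apply/malgP => k.
by rewrite mcoeffmulE !mcoeffU mul1r mulrnAr mulr1.
Qed.

(* the extension of [f] along pure tensors, semilinear over [alpha]; it is
   meaningful when [f] is [alpha]-multilinear, see [tlift_pure] *)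
Definition tlift (R' : comPzRingType) (N : lmodType R') (alpha : R -> R')
    (f : (X -> M) -> N) (t : tens) : N :=
  \sum_(m <- msupp (repr t)) alpha (repr t)@_m *: f m.

Section Lift.
Variables (R' : comPzRingType) (N : lmodType R') (alpha : {rmorphism R -> R'}).
Variable f : (X -> M) -> N.
Hypothesis f_lin : forall m i a x y,
  f (dfwith m i (a *: x + y)) = alpha a *: f (dfwith m i x) + f (dfwith m i y).

Let ext (z : {malg R[X -> M]}) : N := \sum_(m <- msupp z) alpha z@_m *: f m.

Let extEw (d : {fset X -> M}) z : (msupp z `<=` d)%fset ->
  ext z = \sum_(m <- d) alpha z@_m *: f m.
Proof.
move=> le; rewrite [LHS](big_fset_incl _ le) => //= m _ /mcoeff_outdom ->.
by rewrite rmorph0 scale0r.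
Qed.

Let extB : {morph ext : x y / x - y}.
Proof.
move=> x y; pose d := (msupp x `|` msupp y)%fset.
rewrite !(@extEw d) ?fsubsetUl ?fsubsetUr ?msuppB_le //.
rewrite -sumrB; apply: eq_bigr => m _.
by rewrite mcoeffB rmorphB scalerBl.
Qed.

Let extD : {morph ext : x y / x + y}.
Proof.
move=> x y; pose d := (msupp x `|` msupp y)%fset.
rewrite !(@extEw d) ?fsubsetUl ?fsubsetUr ?msuppD_le //.
rewrite -big_split; apply: eq_bigr => m _ /=.
by rewrite mcoeffD rmorphD scalerDl.
Qed.

Let extU c m : ext << c *g m >> = alpha c *: f m.
Proof. by rewrite (extEw msuppU_le) big_seq_fset1 mcoeffUU. Qed.

Let ext_span z : z \in zspan multilin_rels -> ext z = 0.
Proof.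
move=> /asboolP/(_ (fun z => ext z == 0)) E; apply/eqP; apply: E.
  split=> [|x y /eqP x0 /eqP y0]; first by rewrite /ext unfold_in msupp0 big_nil.
  by rewrite unfold_in extB x0 y0 subr0.
move=> _ [c [m [i [a [x [y ->]]]]]]; rewrite unfold_in extB extD !extU f_lin.
by rewrite rmorphM scalerDr scalerA subrr.
Qed.

Lemma tlift_pi z : tlift alpha f (\pi_tens z) = ext z.
Proof.
apply/eqP; rewrite -subr_eq0 -[tlift _ _ _]/(ext _) -extB ext_span //.
by rewrite Quotient.idealrBE reprK.
Qed.

Lemma tlift_pure m : tlift alpha f (tpure m) = f m.
Proof. by rewrite tlift_pi extU rmorph1 scale1r. Qed.

Lemma tliftD : {morph tlift alpha f : t u / t + u}.
Proof.
by move=> t u; rewrite -[t]reprK -[u]reprK tpiD !tlift_pi extD.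
Qed.

Lemma tliftZ a t : tlift alpha f (a *: t) = alpha a *: tlift alpha f t.
Proof.
rewrite -[t]reprK scale_tpi !tlift_pi.
have le : (msupp (mcoeffmul a (repr t)) `<=` msupp (repr t))%fset.
  apply/fsubsetP => m; rewrite -!mcoeff_neq0 mcoeffmulE.
  by apply: contraNneq => ->; rewrite mulr0.
rewrite (extEw le) scaler_sumr; apply: eq_bigr => m _.
by rewrite mcoeffmulE rmorphM scalerA.
Qed.

End Lift.

End TensorPower.

Record modObj := ModObj { mbase : comPzRingType; mcar :> lmodType mbase }.

Record modHom (A B : modObj) := ModHom {
  hbase : {rmorphism mbase A -> mbase B};
  hcar :> {linear A -> B | hbase \; *:%R}
}.

Section FreeObjects.
Variables X Y : choiceType.

(* F(X, Y) = (Z[X]; Z[X](Y)) *)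
Definition freeObj : modObj :=
  @ModObj {malg int[{cmonom X}]} {malg {malg int[{cmonom X}]}[Y]}.

(* the morphism F(X, Y) -> A adjoint to (h, k) : (X, Y) -> U A *)
Variables (A : modObj) (h : X -> mbase A) (k : Y -> A).

Definition monom_eval (m : {cmonom X}) : mbase A :=
  \prod_(x <- finsupp m) h x ^+ m x.

Definition poly_eval (p : mbase freeObj) : mbase A :=
  \sum_(m <- msupp p) (p@_m)%:~R * monom_eval m.

Definition lin_eval (q : freeObj) : A :=
  \sum_(y <- msupp q) poly_eval (q@_y) *: k y.

Lemma monom_evalEw (d : {fset X}) (m : {cmonom X}) :
  (finsupp m `<=` d)%fset -> monom_eval m = \prod_(x <- d) h x ^+ m x.
Proof.
move=> le; rewrite /monom_eval (big_fset_incl _ le) // => x _ /fsfun_dflt ->.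
by rewrite expr0.
Qed.

Lemma monom_evalM : {morph monom_eval : m n / mmul m n >-> m * n}.
Proof.
move=> m n; pose d := (finsupp m `|` finsupp n)%fset.
have le : (finsupp (mmul m n : {cmonom X}) `<=` d)%fset.
  apply/fsubsetP => x; rewrite in_fsetU !mem_finsupp -negb_and.
  by apply: contraNN => /andP[/eqP mx /eqP nx]; rewrite mulcmE mx nx.
rewrite (monom_evalEw le) (@monom_evalEw d m) ?fsubsetUl //.
rewrite (@monom_evalEw d n) ?fsubsetUr // -big_split; apply: eq_bigr => x _ /=.
by rewrite mulcmE exprD.
Qed.

Lemma monom_eval1 : monom_eval mone = 1.
Proof. by rewrite /monom_eval big1 // => x _; rewrite onecmE expr0. Qed.

Lemma poly_evalEw (d : {fset {cmonom X}}) (p : mbase freeObj) :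
  (msupp p `<=` d)%fset ->
  poly_eval p = \sum_(m <- d) (p@_m)%:~R * monom_eval m.
Proof.
move=> le; rewrite /poly_eval (big_fset_incl _ le) // => m _ /mcoeff_outdom ->.
by rewrite mul0r.
Qed.

Lemma poly_eval_is_zmod_morphism : zmod_morphism poly_eval.
Proof.
move=> p q; pose d := (msupp p `|` msupp q)%fset.
rewrite !(@poly_evalEw d) ?fsubsetUl ?fsubsetUr ?msuppB_le // -sumrB.
by apply: eq_bigr => m _; rewrite mcoeffB intrB mulrBl.
Qed.

HB.instance Definition _ :=
  GRing.isZmodMorphism.Build (mbase freeObj) (mbase A) poly_eval
    poly_eval_is_zmod_morphism.

Lemma poly_evalU c m : poly_eval << c *g m >> = c%:~R * monom_eval m.
Proof. by rewrite (poly_evalEw msuppU_le) big_seq_fset1 mcoeffUU. Qed.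

Lemma poly_eval_is_monoid_morphism : monoid_morphism poly_eval.
Proof.
split=> [|p q]; first by rewrite poly_evalU monom_eval1 mulr1.
rewrite [p * q]malgME raddf_sum mulr_suml; apply: eq_bigr => m _ /=.
rewrite raddf_sum mulr_sumr; apply: eq_bigr => n _ /=.
by rewrite poly_evalU monom_evalM intrM mulrACA.
Qed.

HB.instance Definition _ :=
  GRing.isMonoidMorphism.Build (mbase freeObj) (mbase A) poly_eval
    poly_eval_is_monoid_morphism.

Lemma lin_evalEw (d : {fset Y}) (q : freeObj) : (msupp q `<=` d)%fset ->
  lin_eval q = \sum_(y <- d) poly_eval (q@_y) *: k y.
Proof.
move=> le; rewrite /lin_eval (big_fset_incl _ le) // => y _ /mcoeff_outdom ->.
by rewrite raddf0 scale0r.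
Qed.

Lemma lin_eval_is_zmod_morphism : zmod_morphism lin_eval.
Proof.
move=> p q; pose d := (msupp p `|` msupp q)%fset.
rewrite !(@lin_evalEw d) ?fsubsetUl ?fsubsetUr ?msuppB_le // -sumrB.
by apply: eq_bigr => m _; rewrite mcoeffB raddfB scalerBl.
Qed.

HB.instance Definition _ :=
  GRing.isZmodMorphism.Build freeObj A lin_eval lin_eval_is_zmod_morphism.

Lemma lin_eval_is_scalable : scalable_for (poly_eval \; *:%R) lin_eval.
Proof.
move=> c q; rewrite (lin_evalEw (msuppZ_le c q)) /= scaler_sumr.
by apply: eq_bigr => y _; rewrite mcoeffZ rmorphM scalerA.
Qed.

HB.instance Definition _ :=
  GRing.isScalable.Build _ freeObj A (poly_eval \; *:%R) lin_eval
    lin_eval_is_scalable.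

Definition free_adj : modHom freeObj A := @ModHom freeObj A poly_eval lin_eval.

End FreeObjects.

Definition free_map (X X' Y Y' : choiceType) (a : X -> X') (b : Y -> Y') :
  modHom (freeObj X Y) (freeObj X' Y') :=
  @free_adj X Y (freeObj X' Y')
    (fun x => << 1 *g ucm (a x) >>) (fun y => << 1 *g b y >>).

Definition FU (A : modObj) : modObj := freeObj (mbase A) A.

Definition FU_map (A B : modObj) (phi : modHom A B) : modHom (FU A) (FU B) :=
  free_map (hbase phi) phi.

Definition counit (A : modObj) : modHom (FU A) A := @free_adj _ _ A id id.

Lemma dfwith_comp (X : eqType) (M N : Type) (f : M -> N) (m : X -> M) i x :
  f \o dfwith m i x = dfwith (f \o m) i (f x).
Proof.
apply/funext => j /=; have [->|ij] := eqVneq i j; first by rewrite !dfwithin.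
by rewrite !dfwithout.
Qed.

Lemma dfwith_reindex (X Y : eqType) (M : Type) (p : Y -> X) (q : X -> Y)
    (m : X -> M) i x : cancel p q -> cancel q p ->
  dfwith m i x \o p = dfwith (m \o p) (q i) x.
Proof.
move=> pK qK; apply/funext => j /=; have [<-|ij] := eqVneq (q i) j.
  by rewrite qK !dfwithin.
rewrite !dfwithout //; apply: contra_neq ij => ->; exact: pK.
Qed.

Section TensorMaps.
Variables (A : modObj) (X : choiceType).

Definition tens_map (B : modObj) (phi : modHom A B) : tens A X -> tens B X :=
  tlift (hbase phi) (fun m => tpure (phi \o m)).

Lemma tens_map_pure B (phi : modHom A B) m :
  tens_map phi (tpure m) = tpure (phi \o m).
Proof.
apply: tlift_pure => m' i a x y.
by rewrite !dfwith_comp linearD linearZ tpure_lin.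
Qed.

(* for a bijection p : Y -> X, the map relabelling the factors along p^-1 *)
Definition tens_reindex (Y : choiceType) (p : Y -> X) : tens A X -> tens A Y :=
  tlift idfun (fun m => tpure (m \o p)).

Lemma tens_reindex_pure (Y : choiceType) (p : Y -> X) m :
  bijective p -> tens_reindex p (tpure m) = tpure (m \o p).
Proof.
case=> q pK qK; apply: tlift_pure => m' i a x y.
by rewrite !(dfwith_reindex _ _ _ pK qK) tpure_lin.
Qed.

(* the isomorphism M^(X * Z) -> (M^X)^Z, for Z finite *)
Definition tens_curry (Z : choiceType) :
    tens A (X * Z)%type -> tens (tens A X) Z :=
  tlift idfun (fun m => tpure (fun z => tpure (fun x => m (x, z)))).

(* the tensor power of n indexed by Z: the preimage of (x)_(z in Z) n *)
Definition tens_pow (Z : choiceType) (n : tens A X) : tens A (X * Z)%type :=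
  xget 0 [set t | tens_curry t = tpure (fun _ : Z => n)].

End TensorMaps.

Section TensorProducts.
Variable G : topologicalGroupType.
Implicit Types (S : set (openSubgroup G)) (A B : modObj).

(* The product over U in S of the discrete groups M^(G/U). The group gh is its
   subspace of H-invariant elements. The ghost maps below land in gh but are
   typed as maps to the product: an equation in gh is an equation in the
   product, and im(w) has the same topology in both. *)
Definition tprod S A := forall U : set_type S, tens A (cosets (set_val U)).

HB.instance Definition _ S A := Topological.copy (tprod S A)
  (prod_topology (fun U : set_type S =>
     discrete_topology (tens A (cosets (set_val U))))).

Section Zmodule.
Variables (S : set (openSubgroup G)) (A : modObj).
Implicit Types x y z : tprod S A.

Definition tprod0 : tprod S A := fun=> 0.
Definition tprod_opp x : tprod S A := fun U => - x U.
Definition tprod_add x y : tprod S A := fun U => x U + y U.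

Lemma tprod_addA : associative tprod_add.
Proof. by move=> x y z; apply: functional_extensionality_dep => U; apply: addrA. Qed.

Lemma tprod_addC : commutative tprod_add.
Proof. by move=> x y; apply: functional_extensionality_dep => U; apply: addrC. Qed.

Lemma tprod_add0 : left_id tprod0 tprod_add.
Proof. by move=> x; apply: functional_extensionality_dep => U; apply: add0r. Qed.

Lemma tprod_addN : left_inverse tprod0 tprod_opp tprod_add.
Proof. by move=> x; apply: functional_extensionality_dep => U; apply: addNr. Qed.

HB.instance Definition _ := GRing.isZmodule.Build (tprod S A)
  tprod_addA tprod_addC tprod_add0 tprod_addN.

Lemma tprod_sub_continuous :
  continuous (fun xy : tprod S A * tprod S A => xy.1 - xy.2).
Proof.
have coord (z : tprod S A) U : nbhs z [set z' : tprod S A | z' U = z U].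
  pose K U := discrete_topology (tens A (cosets (@set_val _ S U))).
  apply: (@proj_continuous _ K U z [set t | t = z U]).
  exact: discrete_set1.
move=> [x y]; apply/cvg_sup => U N [B [[W _ <-] /= Wxy] WN].
exists ([set z | z U = x U], [set z | z U = y U]); first by split; apply: coord.
move=> [x' y'] /= [x'U y'U]; apply: WN => /=.
by have -> : (x' - y') U = (x - y) U by congr (_ - _).
Qed.

(* the closure of the subgroup generated by [D] *)
Definition closed_span (D : set (tprod S A)) : set (tprod S A) :=
  closure [set x | x \in zspan D].

Lemma closed_spanB D x y :
  closed_span D x -> closed_span D y -> closed_span D (x - y).
Proof.
move=> Dx Dy N /(@tprod_sub_continuous (x, y)) [[P Q] /= [Px Qy] PQN].
have [x' [Dx' Px']] := Dx _ Px; have [y' [Dy' Qy']] := Dy _ Qy.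
exists (x' - y'); split; first exact: rpredB.
exact: (PQN (x', y')).
Qed.

End Zmodule.

(* the U-component of x, extended by 0 to all U not in S *)
Definition tprod_at S A (x : tprod S A) (U : openSubgroup G) :
    tens A (cosets U) :=
  if pselect (U \in S) is left SU then x (exist _ U SU) else 0.

Definition tprod_map S A B (phi : modHom A B) (x : tprod S A) : tprod S B :=
  fun U => tens_map phi (x U).

(* the map g : M^(G/U) -> M^(G/V), for V = g U g^-1 *)
Definition tens_act A (g : G) (U V : openSubgroup G) :
    tens A (cosets U) -> tens A (cosets V) :=
  tens_reindex (fun c : cosets V => \pi_(cosets U) (repr c * g)%g).

End TensorProducts.
Arguments tens_act {G A} g {U V}.

Section Witt.
Variable G : topologicalGroupType.
Implicit Types (U V H K : openSubgroup G) (S : set (openSubgroup G)).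

(* The choices behind the ghost map; only the values of [crep] at V in [reps]
   are used. *)
Record ghostChoice H S := GhostChoice {
  reps : set (openSubgroup G);
  reps_sub : reps `<=` S;
  reps_ex : forall U, S U ->
    exists V h, [/\ reps V, osub H h & U = conjos h V];
  reps_uniq : forall V V' h,
    reps V -> reps V' -> osub H h -> V' = conjos h V -> V' = V;
  crep : forall V, cosets V -> G;
  crepK : forall V, cancel (@crep V) \pi_(cosets V)
}.

Section CosetDecomposition.
Variables (V U : openSubgroup G) (r : cosets V -> G).
Hypothesis rK : cancel r \pi_(cosets V).

Lemma crep_div (a : G) : ((r (\pi_(cosets V) a))^-1 * a)%g \in (V : set G).
Proof.
by apply: mem_set; apply/asboolP/(@lcosetsP _ _ id V); rewrite [LHS]rK.
Qed.

(* the bijection (g_i V, s U) |-> g_i s U, for U <= V, and its inverse *)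
Definition coset_join (bz : cosets V * relcosets V U) : cosets U :=
  \pi_(cosets U) (r bz.1 * set_val (repr bz.2))%g.

Definition coset_split (c : cosets U) : cosets V * relcosets V U :=
  (\pi_(cosets V) (repr c),
   \pi_(relcosets V U) (exist (fun a => a \in (V : set G)) _ (crep_div (repr c)))).

Lemma coset_splitK : cancel coset_split coset_join.
Proof.
move=> c; rewrite /coset_join /coset_split /=.
set v := exist _ _ _; rewrite -[RHS]reprK; apply/lcosetsP/asboolP => /=.
have /lcosetsP/asboolP := reprK (\pi_(relcosets V U) v).
by rewrite /= invgM -mulgA.
Qed.

Lemma coset_joinK : U `<=` V -> cancel coset_join coset_split.
Proof.
move=> UV [b z]; rewrite /coset_join /coset_split /=.
set a := (r b * _)%g; set a' := repr _.
have a'a : osub U (a'^-1 * a)%g.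
  by apply/asboolP/(@lcosetsP _ _ id U); rewrite reprK.
have eb : \pi_(cosets V) a' = b.
  rewrite -[b]rK; apply/(@lcosetsP _ _ id V)/asboolP.
  have Vz : osub V (set_val (repr z)) by apply: set_mem; apply: valP.
  have := osubM (UV _ a'a) (osubV Vz).
  by rewrite /a -!mulgA mulgV mulg1.
congr (_, _); first exact: eb.
rewrite -[RHS]reprK; apply/lcosetsP/asboolP => /=.
suff : osub U (((r (\pi_(cosets V) a'))^-1 * a')^-1 * set_val (repr z))%g.
  by [].
by rewrite eb invgM invgK -mulgA.
Qed.

End CosetDecomposition.

Section Ghost.
Variables (H : openSubgroup G) (S : set (openSubgroup G)).
Variable ch : ghostChoice H S.

(* the map f_(G/V) : M^(G/V x V/U) -> M^(G/U), for U <= V *)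
Definition coset_tens (A : modObj) (V U : openSubgroup G) :
    tens A (cosets V * relcosets V U)%type -> tens A (cosets U) :=
  tens_reindex (@coset_split V U (crep ch (V:=V)) (crepK ch (V:=V))).

(* h . f_(G/V) (n^(V / h^-1 U h)), in M^(G/U) *)
Definition ghost_term (A : modObj) (U V : openSubgroup G) (h : G)
    (n : tens A (cosets V)) : tens A (cosets U) :=
  tens_act h (coset_tens (tens_pow (relcosets V (conjos h^-1%g U)) n)).

(* (H/V)^U *)
Definition fixed_cosets (U V : openSubgroup G) : set (relcosets H V) :=
  [set c | conjos (set_val (repr c))^-1%g U `<=` V].
Arguments fixed_cosets : clear implicits.

(* the ghost map on the product of the M^(G/V), V in [reps ch]; the sums have
   finite support because G is compact *)
Definition ghost_poly (A : modObj) (n : tprod (reps ch) A) : tprod S A :=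
  fun U : set_type S => \sum_(V \in reps ch) \sum_(c \in fixed_cosets (set_val U) V)
    ghost_term (set_val U) (set_val (repr c)) (tprod_at n V).

(* im(w); it is used at the free objects FU B and FUFU B only, where it is a
   closed subgroup *)
Definition free_witt (A : modObj) : set (tprod S A) := range (@ghost_poly A).
Arguments free_witt : clear implicits.

Section WittVectors.
Variable A : modObj.

Definition witt_diff : set (tprod S (FU A)) :=
  [set tprod_map (counit (FU A)) z - tprod_map (FU_map (counit A)) z
    | z in free_witt (FU (FU A))].

(* im(w) being a subgroup, the differences [witt_diff] form a subgroup already,
   and x - y is in im(w); so x - y is in the closure taken in the product iff
   it is in the closure taken in im(w). *)
Definition witt_eq (x y : free_witt (FU A)) : bool :=
  `[< closed_span witt_diff (set_val x - set_val y) >].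

Lemma witt_eq_equiv : equiv_class_of witt_eq.
Proof.
have span0 : closed_span witt_diff 0.
  by apply: subset_closure; rewrite /= rpred0.
split=> [x|x y|y x z].
- by apply/asboolP; rewrite subrr.
- by apply/asboolP/asboolP => /(closed_spanB span0); rewrite sub0r opprB.
- move=> /asboolP xy /asboolP yz; apply/asboolP.
  have := closed_spanB xy (closed_spanB span0 yz).
  by rewrite sub0r opprK addrA subrK.
Qed.

Canonical witt_equiv := EquivRelPack witt_eq_equiv.
Canonical witt_encModRel := defaultEncModRel witt_eq.

(* the coequaliser of W(FUFU A) => W(FU A) *)
Definition witt : Type := quotient_topology {eq_quot witt_eq}.
HB.instance Definition _ := Topological.on witt.
HB.instance Definition _ := Quotient.on witt.

(* The addition induced by that of im(w). As im(w) is a subgroup, the sum below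
   lies in it and the default value given to [insubd] is never used. *)
Definition witt_add (x y : witt) : witt :=
  \pi_witt (insubd (repr x) (set_val (repr x) + set_val (repr y))).

(* the map induced on the quotient by im(w) -> gh(FU A) -> gh(A) *)
Definition ghost (x : witt) : tprod S A :=
  tprod_map (counit A) (set_val (repr x)).

End WittVectors.

Lemma free_witt0 A : ghost_poly (0 : tprod (reps ch) A) \in free_witt A.
Proof. by apply: mem_set; exists 0. Qed.

(* The default of [insubd] is never used either: gh(FU phi) maps im(w) to
   im(w). *)
Definition witt_map A B (phi : modHom A B) (x : witt A) : witt B :=
  \pi_(witt B) (insubd (exist (fun y => y \in free_witt (FU B)) _ (free_witt0 (FU B)))
    (tprod_map (FU_map phi) (set_val (repr x)))).

End Ghost.

Definition tprod_act S A (g : G) (x : tprod S A) : tprod S A :=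
  fun U : set_type S => tens_act g (tprod_at x (conjos g^-1%g (set_val U))).

Definition extend0 K S A (x : tprod (restr_trunc S K) A) : tprod S A :=
  fun U : set_type S => tprod_at x (set_val U).

(* independent of the representatives of H/K when x is K-invariant *)
Definition transfer H K S A (x : tprod S A) : tprod S A :=
  \sum_(c \in [set: relcosets H K]) tprod_act (set_val (repr c)) x.

Definition ghost_verschiebung H K S A (x : tprod (restr_trunc S K) A) :
    tprod S A :=
  transfer H K (extend0 x).

(* natural transformations between functors to Ab_Haus *)
Definition witt_nat H K S S' (ch : ghostChoice K S') (ch' : ghostChoice H S)
    (V : forall A, witt ch A -> witt ch' A) : Prop :=
  [/\ forall A, continuous (V A),
      forall A x y, V A (witt_add x y) = witt_add (V A x) (V A y) &
      forall A B (phi : modHom A B) x,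
        V B (witt_map phi x) = witt_map phi (V A x)].

End Witt.
Arguments ghost_verschiebung {G} H K {S A} x.

(* Main.v *)
(* Write tau_V(p) for the ghost image of a pure tensor p in M^(G/V). Let L be the
   group of all locally finite integral combinations of the tau_V(p); it depends
   on none of the choices behind the ghost map. For any n = p_1 + ... + p_k with
   p_i pure, the V-th summand of the ghost map counts the points of the H-set
   H x_V Map(V, {1..k}), labelled by pure tensors. Its decomposition into orbits
   shows that this summand is the sum of the tau_V(p_i), from the constant maps,
   and of terms tau_W(q) with W of larger index than V, from the other maps.
   Hence the ghost map takes values in L, and it is onto L by recursion on the
   index. So im(w) = L is a subgroup, also when M is not free.

   The transfer sends tau_V(p) for K to tau_V(p) for H, hence L for K into L for
   H. As it is additive, continuous and natural on the ghost groups, it descends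
   to the coequalisers. For uniqueness, the counit FU A -> A is onto on Witt
   vectors, and the ghost map of W(FU A) is injective, because the coequaliser
   that defines W(FU A) splits. *)

From HB Require Import structures.
Require Import Defs.
From mathcomp Require Import all_boot all_algebra finmap.
From mathcomp Require Import all_classical topology.
From mathcomp Require Import monalg.

Set Implicit Arguments.
Unset Strict Implicit.
Unset Printing Implicit Defensive.

Import GRing.Theory.
Local Open Scope classical_set_scope.
Local Open Scope quotient_scope.
Local Open Scope ring_scope.

(** * Tensor powers *)

(** The Witt coordinates are unsuited to the transfer. Subgroups that are not conjugate in [K] may
    become conjugate in [H], the choices made for [K] and for [H] are unrelated, and coordinates
    that collide cannot simply be added, since the power n^(V/U) is not additive in n. The span L
    has no coordinates and the transfer acts on it additively; the price is a proof that L is the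
    image of the ghost map.

    A pure tensor in M^(G/V) is carried as a right V-invariant function q on G. All subgroups then
    share one type, and h in H acts by right translation, a |-> q (a h), without transport between
    G/V and G/hVh^-1. The orbit of a function with stabilizer V is H/V, which turns the summands of
    the ghost map into sums over fixed points.

    A combination may involve infinitely many V, but its U-component sees only those that contain an
    H-conjugate of U. They are finitely many as G is compact, so identities are checked at one U at
    a time. *)

Section Multilinear.
Variables (R R' : comPzRingType) (alpha : R -> R') (M : lmodType R).
Variables (N : lmodType R') (X : eqType).

Definition multilinear (f : (X -> M) -> N) := forall m i a x y,
  f (dfwith m i (a *: x + y)) = alpha a *: f (dfwith m i x) + f (dfwith m i y).

End Multilinear.

Section TensorFacts.
Variables (R : comPzRingType) (M : lmodType R) (X : choiceType).
Implicit Types (t : tens M X) (m : X -> M).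

Lemma tens_expand t :
  t = \sum_(m <- msupp (repr t)) (repr t)@_m *: (tpure m : tens M X).
Proof.
rewrite -{1}[t]reprK {1}[repr t]monalgE [LHS](raddf_sum (\pi_(tens M X))).
apply: eq_bigr => m _; rewrite /tpure scale_tpi; congr (\pi_(tens M X) _).
by apply/malgP => k; rewrite mcoeffmulE !mcoeffU mulrnAr mulr1.
Qed.

Lemma tens_ind (P : tens M X -> Prop) :
  P 0 -> (forall t u, P t -> P u -> P (t + u)) ->
  (forall c m, P (c *: tpure m)) -> forall t, P t.
Proof.
move=> P0 PD Pp t; rewrite (tens_expand t).
by elim/big_ind: _ => // m _; apply: Pp.
Qed.

Lemma multilinear_tpure : multilinear idfun (@tpure R M X).
Proof. by move=> m i a x y; rewrite tpure_lin. Qed.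

Lemma multilinear0 (R' : comPzRingType) (N : lmodType R')
    (alpha : {rmorphism R -> R'}) (f : (X -> M) -> N) m i :
  multilinear alpha f -> f (dfwith m i 0) = 0.
Proof.
move=> fl; have := fl m i 1 0 0.
rewrite scaler0 addr0 rmorph1 scale1r => E.
by apply: (addrI (f (dfwith m i 0))); rewrite -E addr0.
Qed.

Lemma tpure_slotZ m i a : tpure (dfwith m i (a *: m i)) = a *: tpure m.
Proof.
have := tpure_lin m i a (m i) 0.
rewrite addr0 (multilinear0 m i multilinear_tpure) addr0 => ->.
congr (_ *: tpure _); apply/funext => j.
by have [<-|ij] := eqVneq i j; rewrite ?dfwithin ?dfwithout.
Qed.

(** The family [pq] is fixed before [W] and [F], because [ghost_summand_add] needs the same one for
    the pure tensors and for their contributions [tau]. *)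
Lemma big_ord_cat (T : Type) k l (p : 'I_k.+1 -> T) (q : 'I_l.+1 -> T) :
  exists pq : 'I_(k + l.+1).+1 -> T, forall (W : nmodType) (F : T -> W),
    \sum_i F (pq i) = \sum_i F (p i) + \sum_i F (q i).
Proof.
exists (fun i : 'I_(k.+1 + l.+1) =>
  match fintype.split i with inl a => p a | inr b => q b end) => W F.
rewrite [LHS](@big_split_ord _ _ _ k.+1 l.+1) /=.
congr (_ + _); apply: eq_bigr => i _.
  by rewrite -[lshift _ _]/(unsplit (inl i)) unsplitK.
by rewrite -[rshift _ _]/(unsplit (inr i)) unsplitK.
Qed.

(** Coefficients are absorbed into the factor at [i0], and 0 is a pure tensor with factor 0 there.
    Keeping at least one summand makes [ord0] available as a default label. *)
Lemma tens_sum_pure (i0 : X) t :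
  exists k (p : 'I_k.+1 -> X -> M), t = \sum_i tpure (p i).
Proof.
elim/tens_ind: t => [|_ _ [k [p ->]] [l [q ->]]|c m].
- exists 0, (fun _ => dfwith (fun=> 0) i0 0).
  by rewrite big_ord1 (multilinear0 _ i0 multilinear_tpure).
- have [pq E] := big_ord_cat p q.
  by exists (k + l.+1)%N, pq; rewrite E.
- by exists 0, (fun _ => dfwith m i0 (c *: m i0)); rewrite big_ord1 tpure_slotZ.
Qed.

Lemma tlift_linl (N : lmodType R) a (f g : (X -> M) -> N) t :
  tlift idfun (fun m => a *: f m + g m) t = a *: tlift idfun f t + tlift idfun g t.
Proof.
rewrite /tlift scaler_sumr -big_split; apply: eq_bigr => m _ /=.
by rewrite scalerDr !scalerA mulrC.
Qed.

Lemma eq_tlift (N : lmodType R) (f g : (X -> M) -> N) t :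
  f =1 g -> tlift idfun f t = tlift idfun g t.
Proof. by move=> fg; apply: eq_bigr => m _; rewrite fg. Qed.

End TensorFacts.

(** * Currying of tensors and the tensor power of a sum *)

Lemma curry_dfwith (X Z : eqType) (M : Type) (m : X * Z -> M) x z v z' :
  (fun x' => dfwith m (x, z) v (x', z')) =
  dfwith (fun z x => m (x, z)) z (dfwith (fun x => m (x, z)) x v) z'.
Proof.
apply/funext => x'; have [<-|zz'] := eqVneq z z'.
  rewrite dfwithin; have [<-|xx'] := eqVneq x x'; first by rewrite !dfwithin.
  by rewrite !dfwithout // xpair_eqE (negbTE xx').
by rewrite !dfwithout // xpair_eqE (negbTE zz') andbF.
Qed.

Section Curry.
Variables (A : modObj) (X Z : choiceType).

Let cur (m : X * Z -> A) : tens (tens A X) Z :=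
  tpure (fun z => tpure (fun x => m (x, z))).

Lemma multilinear_curry : multilinear idfun cur.
Proof.
move=> m [x z] a u v; rewrite /cur.
have E w : (fun z' => tpure (fun x' => dfwith m (x, z) w (x', z'))) =
    dfwith (fun z => tpure (fun x => m (x, z))) z
      (tpure (dfwith (fun x => m (x, z)) x w) : tens A X).
  apply/funext => z'; rewrite curry_dfwith.
  by have [<-|zz'] := eqVneq z z'; rewrite ?dfwithin ?dfwithout.
by rewrite !E tpure_lin tpure_lin.
Qed.

Lemma tens_curryD (t u : tens A (X * Z)%type) :
  tens_curry (t + u) = tens_curry t + tens_curry u.
Proof. exact: (@tliftD _ _ _ _ _ idfun _ multilinear_curry). Qed.

Lemma tens_curryZ a (t : tens A (X * Z)%type) :
  tens_curry (a *: t) = a *: tens_curry t.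
Proof. exact: (@tliftZ _ _ _ _ _ idfun _ multilinear_curry). Qed.

Lemma tens_curry_pure (m : X * Z -> A) :
  tens_curry (tpure m) = tpure (fun z => tpure (fun x => m (x, z))).
Proof. exact: (@tlift_pure _ _ _ _ _ idfun _ multilinear_curry). Qed.

Let upd (m : X * Z -> A) (z : Z) (p : X -> A) : X * Z -> A :=
  fun xz => if xz.2 == z then p xz.1 else m xz.

(* the product of the tensors n z for z in zs and of the vectors m (x, z) for
   z not in zs *)
Fixpoint uncurry_on (zs : seq Z) (n : Z -> tens A X) (m : X * Z -> A) :
    tens A (X * Z)%type :=
  if zs is z :: zs' then
    tlift idfun (fun p => uncurry_on zs' n (upd m z p)) (n z)
  else tpure m.

Let uncurry_on_slot zs n m x z (a : mbase A) (u v : A) : z \notin zs ->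
  uncurry_on zs n (dfwith m (x, z) (a *: u + v)) =
  a *: uncurry_on zs n (dfwith m (x, z) u) + uncurry_on zs n (dfwith m (x, z) v).
Proof.
elim: zs m => [|z0 zs IH] m /=; first by rewrite tpure_lin.
rewrite inE negb_or => /andP[zz0 zzs].
have E w p : upd (dfwith m (x, z) w) z0 p = dfwith (upd m z0 p) (x, z) w.
  apply/funext => -[x' z']; rewrite /upd /=; case: eqP => [->|/eqP z'z0].
    by rewrite dfwithout ?eqxx // xpair_eqE (negbTE zz0) andbF.
  have [<-|ne] := eqVneq (x, z) (x', z'); first by rewrite !dfwithin.
  by rewrite !dfwithout //= (negbTE z'z0).
rewrite -tlift_linl; apply: eq_tlift => p.
by rewrite !E IH.
Qed.

Let uncurry_on_upd zs n m z : z \notin zs ->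
  multilinear idfun (fun p => uncurry_on zs n (upd m z p)).
Proof.
move=> zzs p x a u v.
have E w : upd m z (dfwith p x w) = dfwith (upd m z p) (x, z) w.
  apply/funext => -[x' z']; rewrite /upd /=; case: eqP => [->|/eqP z'z].
    have [<-|ne] := eqVneq x x'; first by rewrite !dfwithin.
    by rewrite !dfwithout ?xpair_eqE ?(negbTE ne) //= eqxx.
  rewrite dfwithout /= ?(negbTE z'z) //.
  by rewrite xpair_eqE [z == _]eq_sym (negbTE z'z) andbF.
by rewrite !E uncurry_on_slot.
Qed.

Let eq_uncurry_on zs n n' m :
  {in zs, n =1 n'} -> uncurry_on zs n m = uncurry_on zs n' m.
Proof.
elim: zs m => //= z zs IH m nn'; rewrite nn' ?mem_head //.
by apply: eq_tlift => p; apply: IH => z' z'zs; apply: nn'; rewrite inE z'zs orbT.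
Qed.

Let uncurry_on_lin zs n m z (a : mbase A) (u v : tens A X) : uniq zs -> z \in zs ->
  uncurry_on zs (dfwith n z (a *: u + v)) m =
  a *: uncurry_on zs (dfwith n z u) m + uncurry_on zs (dfwith n z v) m.
Proof.
elim: zs m => //= z0 zs IH m /andP[z0zs uzs]; rewrite inE.
case: (eqVneq z z0) => [->|zz0] /= zzs.
  have E w p : uncurry_on zs (dfwith n z0 w) p = uncurry_on zs n p.
    apply: eq_uncurry_on => z' z'zs; rewrite dfwithout //.
    by apply: contraNneq z0zs => ->.
  rewrite !dfwithin !(eq_tlift _ (fun p => E _ _)).
  have L := @uncurry_on_upd zs n m _ z0zs.
  by rewrite (@tliftD _ _ _ _ _ idfun _ L) (@tliftZ _ _ _ _ _ idfun _ L).
by rewrite !(dfwithout _ _ zz0) -tlift_linl; apply: eq_tlift => p; rewrite IH.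
Qed.

Let uncurry_on_pure zs (q : Z -> X -> A) m : uniq zs ->
  uncurry_on zs (fun z => tpure (q z)) m =
  tpure (fun xz => if xz.2 \in zs then q xz.2 xz.1 else m xz).
Proof.
elim: zs m => [|z zs IH] m /=; first by move=> _; congr tpure; apply/funext.
move=> /andP[zzs uzs].
rewrite (@tlift_pure _ _ _ _ _ idfun _ (@uncurry_on_upd zs _ m _ zzs)) IH //.
congr tpure; apply/funext => -[x z']; rewrite /= inE /upd /=.
by have [->|] := eqVneq z' z; rewrite ?(negbTE zzs).
Qed.

Hypothesis finZ : finite_set [set: Z].

(** A left inverse is built by one multilinear extension for each element of the finite set [Z].
    Injectivity is what makes the preimage chosen in [tens_pow] unique. *)
Lemma tens_curry_inj : injective (@tens_curry A X Z).
Proof.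
pose zs : seq Z := fset_set [set: Z].
have uzs : uniq zs by apply: fset_uniq.
have azs z : z \in zs by rewrite in_fset_set // inE.
pose f (n : Z -> tens A X) := uncurry_on zs n (fun=> 0).
have fl : multilinear idfun f by move=> n z a u v; exact: uncurry_on_lin.
apply: (@can_inj _ _ _ (tlift idfun f)); elim/tens_ind => [|t u tK uK|c m].
- have E : tens_curry (0 : tens A (X * Z)%type) = 0.
    by rewrite -[X in tens_curry X](scale0r 0) tens_curryZ scale0r.
  rewrite E -[X in tlift _ _ X](scale0r 0).
  by rewrite (@tliftZ _ _ _ _ _ idfun _ fl) scale0r.
- by rewrite tens_curryD (@tliftD _ _ _ _ _ idfun _ fl) tK uK.
- rewrite tens_curryZ (@tliftZ _ _ _ _ _ idfun _ fl) tens_curry_pure.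
  rewrite (@tlift_pure _ _ _ _ _ idfun _ fl) /f uncurry_on_pure //.
  by congr (_ *: tpure _); apply/funext => -[x z]; rewrite /= azs.
Qed.

End Curry.

Section Expand.
Variables (R : comPzRingType) (N W : lmodType R) (Z : choiceType) (k : nat).
Variable f : (Z -> N) -> W.
Hypothesis fl : multilinear idfun f.

Let upd (phi : Z -> 'I_k.+1) z i : Z -> 'I_k.+1 :=
  fun z' => if z' == z then i else phi z'.

(** The choices of a summand at each point of [zs], extended by [ord0]. When [zs] enumerates [Z],
    every function on [Z] occurs exactly once. *)
Let Fixpoint expansions (zs : seq Z) : seq (Z -> 'I_k.+1) :=
  if zs is z :: zs' then
    [seq upd phi z i | phi <- expansions zs', i <- enum 'I_k.+1]
  else [:: fun=> ord0].

Let expansionsP zs phi :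
  phi \in expansions zs <-> forall z, z \notin zs -> phi z = ord0.
Proof.
elim: zs phi => [|z zs IH] phi /=.
  rewrite inE; split=> [/eqP-> //|E]; apply/eqP/funext => z; exact: E.
split=> [/allpairsP[[psi i] /= [/IH psizs _ ->]] z'|E].
  by rewrite inE negb_or /upd => /andP[/negbTE-> /psizs].
apply/allpairsP; exists (upd phi z ord0, phi z); split=> /=.
- apply/IH => z' z'zs; rewrite /upd; case: eqP => // /eqP z'z.
  by apply: E; rewrite inE negb_or z'z.
- by rewrite mem_enum.
- by apply/funext => z'; rewrite /upd; case: eqP => [->|].
Qed.

Let expansions_uniq zs : uniq zs -> uniq (expansions zs).
Proof.
elim: zs => //= z zs IH /andP[zzs uzs].
apply: allpairs_uniq; rewrite ?enum_uniq ?IH // => -[phi i] [psi j].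
move=> /allpairsP[[a b] /= [phiE _ [phia _]]]; rewrite -{}phia in phiE.
move=> /allpairsP[[c d] /= [psiE _ [psic _]]]; rewrite -{}psic in psiE => E.
have := congr1 (fun h => h z) E; rewrite /upd eqxx => ->; congr (_, _).
apply/funext => z'; have := congr1 (fun h => h z') E; rewrite /upd.
case: eqP => // -> _.
by move/expansionsP: phiE => ->//; move/expansionsP: psiE => ->.
Qed.

Let expand_on (t : 'I_k.+1 -> Z -> N) zs u : uniq zs ->
  f (fun z => if z \in zs then \sum_i t i z else u z) =
  \sum_(phi <- expansions zs) f (fun z => if z \in zs then t (phi z) z else u z).
Proof.
elim: zs u => [|z zs IH] u /=.
  by rewrite big_seq1 => _; congr f; apply/funext.
move=> /andP[zzs uzs]; rewrite big_allpairs_dep /=.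
(* The slot [z] is singled out while the slots in [zs] keep their sums: the sum at [z] is expanded
   first, then the induction hypothesis expands the others. *)
pose g w z' := if z' \in zs then \sum_i t i z' else if z' == z then w else u z'.
have gE w : g w = dfwith (g 0) z w.
  apply/funext => z'; rewrite /g; have [->|zz'] := eqVneq z' z.
    by rewrite (negbTE zzs) dfwithin.
  by rewrite [RHS]dfwithout ?(negbTE zz') // eq_sym.
have fg_sum (r : seq 'I_k.+1) (F : 'I_k.+1 -> N) :
    f (g (\sum_(i <- r) F i)) = \sum_(i <- r) f (g (F i)).
  elim: r => [|i r IHr]; first by rewrite !big_nil gE (multilinear0 _ _ fl).
  rewrite !big_cons -IHr gE -[F i]scale1r fl -!gE.
  by rewrite !scale1r.
have -> : (fun z' => if z' \in z :: zs then \sum_i t i z' else u z') =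
    g (\sum_i t i z).
  apply/funext => z'; rewrite /g inE; case: eqP => [->|//].
  by rewrite (negbTE zzs).
rewrite fg_sum exchange_big [RHS]big_enum /=; apply: eq_bigr => i _.
rewrite /g IH //; rewrite big_seq [RHS]big_seq; apply: eq_bigr => phi.
move=> /expansionsP phiE; congr f; apply/funext => z'; rewrite inE /upd.
by case: eqP => [->|]; rewrite ?(negbTE zzs).
Qed.

Hypothesis finZ : finite_set [set: Z].

Let zs : seq Z := fset_set [set: Z].
Let zsT z : z \in zs. Proof. by rewrite in_fset_set // inE. Qed.

Lemma finite_ord_fun : finite_set [set: Z -> 'I_k.+1].
Proof.
have -> : [set: Z -> 'I_k.+1] = [set` expansions zs].
  apply/seteqP; split=> // phi _ /=; apply/expansionsP => z.
  by rewrite zsT.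
exact: finite_seq.
Qed.

Lemma multilinear_expand (t : 'I_k.+1 -> Z -> N) :
  f (fun z => \sum_i t i z) =
  \sum_(phi \in [set: Z -> 'I_k.+1]) f (fun z => t (phi z) z).
Proof.
have uzs : uniq zs by apply: fset_uniq.
have -> : [set: Z -> 'I_k.+1] = [set` expansions zs].
  apply/seteqP; split=> // phi _ /=; apply/expansionsP => z.
  by rewrite zsT.
have := expand_on t (fun=> 0) uzs; rewrite (_ : (fun z => if _ then _ else _) =
  (fun z => \sum_i t i z)); last by apply/funext => z; rewrite zsT.
move=> ->; rewrite -fsbig_seq ?expansions_uniq //.
by apply: eq_bigr => phi _; congr f; apply/funext => z; rewrite zsT.
Qed.

End Expand.

(** Multinomial expansion: currying sends the right-hand side to the power of the sum, and
    [tens_curry] is injective. *)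
Lemma tens_pow_sum (A : modObj) (X Z : choiceType) k (p : 'I_k.+1 -> X -> A) :
  finite_set [set: Z] ->
  tens_pow Z (\sum_i tpure (p i)) =
  \sum_(phi \in [set: Z -> 'I_k.+1]) tpure (fun xz => p (phi xz.2) xz.1).
Proof.
move=> finZ; have finF := @finite_ord_fun Z k finZ.
set t := RHS; suff tE : tens_curry t = tpure (fun _ : Z => \sum_i tpure (p i)).
  by apply: xget_unique => // u /= uE; apply: (tens_curry_inj finZ); rewrite uE.
rewrite (multilinear_expand (@multilinear_tpure _ _ Z) finZ).
rewrite /t !fsbig_finite // (big_morph _ (@tens_curryD _ _ _) (id1 := 0)).
  by apply: eq_bigr => phi _; rewrite tens_curry_pure.
by rewrite -[X in tens_curry X](scale0r 0) tens_curryZ scale0r.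
Qed.

(** * Finite sums and open subgroups *)

Section FiniteSums.
Variables (I J : choiceType) (V W : zmodType).

Lemma fsbig_partition (A : set I) (B : set J) (g : I -> J) (F : I -> V) :
  finite_set A -> finite_set B -> (forall i, A i -> B (g i)) ->
  \sum_(i \in A) F i = \sum_(j \in B) \sum_(i \in A `&` g @^-1` [set j]) F i.
Proof.
move=> fA fB AB; under [RHS]eq_fsbigr do rewrite fsbig_mkcondr.
rewrite [RHS]exchange_fsbig //; apply: eq_fsbigr => i /set_mem Ai.
rewrite -(@fsbig_widen _ _ _ _ [set g i] B); first last.
- by move=> j [_ /= gij]; rewrite ifF //; apply: memNset => /= E; apply: gij.
- by move=> _ ->; apply: AB.
by rewrite fsbig_set1 ifT // inE.
Qed.

Lemma fsbig_morph (f : V -> W) (A : set I) (F : I -> V) :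
  f 0 = 0 -> {morph f : x y / x + y} -> finite_set A ->
  f (\sum_(i \in A) F i) = \sum_(i \in A) f (F i).
Proof.
by move=> f0 fD fA; rewrite !fsbig_finite // (big_morph f fD f0).
Qed.

Lemma fsbigDE (A : set I) (F F' : I -> V) : finite_set A ->
  \sum_(i \in A) F i + \sum_(i \in A) F' i = \sum_(i \in A) (F i + F' i).
Proof. by move=> fA; rewrite !fsbig_finite // big_split. Qed.

Lemma fsbigBE (A : set I) (F F' : I -> V) : finite_set A ->
  \sum_(i \in A) F i - \sum_(i \in A) F' i = \sum_(i \in A) (F i - F' i).
Proof. by move=> fA; rewrite !fsbig_finite // sumrB. Qed.

End FiniteSums.

(* The group laws at the carrier of a topological group, oriented as a complete
   rewriting system. Instantiating the generic laws leaves coercions between the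
   group structures behind that block further rewriting. *)
Section GroupLaws.
Variable G : topologicalGroupType.
Implicit Types x y z : G.

Lemma tmulgA x y z : (x * y * z)%g = (x * (y * z))%g.
Proof. by rewrite mulgA. Qed.
Lemma tmul1g x : (1 * x)%g = x. Proof. exact: mul1g. Qed.
Lemma tmulg1 x : (x * 1)%g = x. Proof. exact: mulg1. Qed.
Lemma tmulVg x : (x^-1 * x)%g = 1%g. Proof. exact: mulVg. Qed.
Lemma tmulgV x : (x * x^-1)%g = 1%g. Proof. exact: mulgV. Qed.
Lemma tmulKg x y : (x^-1 * (x * y))%g = y. Proof. exact: mulKg. Qed.
Lemma tmulVKg x y : (x * (x^-1 * y))%g = y. Proof. exact: mulVKg. Qed.
Lemma tinvg1 : (1^-1 : G)%g = 1%g. Proof. exact: invg1. Qed.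
Lemma tinvgK x : (x^-1^-1)%g = x. Proof. exact: invgK. Qed.
Lemma tinvgM x y : ((x * y)^-1)%g = (y^-1 * x^-1)%g. Proof. exact: invgM. Qed.

Definition tgroupE := (tmulgA, tmul1g, tmulg1, tmulVg, tmulgV, tmulKg, tmulVKg,
  tinvg1, tinvgK, tinvgM).

End GroupLaws.

Section Groups.
Variable G : topologicalGroupType.
Implicit Types (a b g h x y : G) (U V W H : openSubgroup G).

Lemma osub_inj U V : U `<=` V -> V `<=` U -> U = V.
Proof.
case: U V => [U U1 UD Uo] [V V1 VD Vo] /= UV VU.
have E : U = V by apply/seteqP.
by subst V; congr OpenSubgroup; apply: Prop_irrelevance.
Qed.

Lemma osubMl U a b : osub U a -> osub U (a * b)%g <-> osub U b.
Proof.
move=> Ua; split=> [Uab|]; last exact: osubM.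
by rewrite -[b](tmulKg a); apply: osubM => //; apply: osubV.
Qed.

Lemma osubMr U a b : osub U b -> osub U (a * b)%g <-> osub U a.
Proof.
move=> Ub; split=> [Uab|Ua]; last exact: osubM.
by have := osubM Uab (osubV Ub); rewrite !tgroupE.
Qed.

Lemma osubVE U a : osub U a^-1%g <-> osub U a.
Proof. by split=> /osubV //; rewrite tinvgK. Qed.

Lemma conjosE g U x : osub (conjos g U) x = osub U (g^-1 * x * g)%g.
Proof. by rewrite /conjos /= /conjg -tmulgA. Qed.

Lemma conjos1 U : conjos 1%g U = U.
Proof. by apply: osub_inj => x; rewrite conjosE !tgroupE. Qed.

Lemma conjosM g h U : conjos g (conjos h U) = conjos (g * h)%g U.
Proof. by apply: osub_inj => x; rewrite !conjosE !tgroupE. Qed.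

Lemma conjosS g U V : U `<=` V -> conjos g U `<=` conjos g V.
Proof. by move=> UV x; apply: UV. Qed.

Lemma conjosK g U : conjos g^-1%g (conjos g U) = U.
Proof. by rewrite conjosM tmulVg conjos1. Qed.

Lemma conjosKV g U : conjos g (conjos g^-1%g U) = U.
Proof. by rewrite conjosM tmulgV conjos1. Qed.

Lemma conjos_id g U : osub U g -> conjos g U = U.
Proof.
move=> Ug; have UVg := osubV Ug; apply: osub_inj => x; rewrite conjosE.
  by move=> /(osubMr _ Ug)/(osubMl _ UVg).
by move=> Ux; apply/(osubMr _ Ug)/(osubMl _ UVg).
Qed.

Lemma cosetsP U a b :
  \pi_(cosets U) a = \pi_(cosets U) b <-> osub U (a^-1 * b)%g.
Proof.
split=> [E|Uab]; last by apply/(@lcosetsP _ _ id U)/asboolP.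
by apply/asboolP/(@lcosetsP _ _ id U).
Qed.

Lemma repr_cosets U a : osub U (a^-1 * repr (\pi_(cosets U) a))%g.
Proof. by apply/cosetsP; rewrite reprK. Qed.

Lemma relcosets_mem H V (c : relcosets H V) : osub H (set_val (repr c)).
Proof. exact: set_mem (valP (repr c)). Qed.

Lemma relcosets_inj H V (c d : relcosets H V) :
  osub V ((set_val (repr c))^-1 * set_val (repr d))%g -> c = d.
Proof.
move=> Vcd; rewrite -[c]reprK -[d]reprK.
by apply/(@lcosetsP _ _ (@set_val _ (H : set G)) V)/asboolP.
Qed.

Lemma relcosets_ex H V h : osub H h ->
  exists c : relcosets H V, osub V ((set_val (repr c))^-1 * h)%g.
Proof.
move=> Hh; pose x : set_type (H : set G) := exist _ h (mem_set Hh).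
exists (\pi_(relcosets H V) x).
by have /lcosetsP/asboolP := reprK (\pi_(relcosets H V) x).
Qed.

Lemma lmul_continuous g : continuous (fun x : G => (g * x)%g).
Proof.
move=> x; apply: (@continuous_comp _ _ _ (fun y : G => (g, y)) (fun z => (z.1 * z.2)%g)).
  by apply: cvg_pair; [exact: cvg_cst | exact: cvg_id].
exact: mulg_continuous.
Qed.

Lemma open_ltranslate U g : open [set x | osub U (g * x)%g].
Proof.
apply: (@open_comp _ _ (fun x : G => (g * x)%g) U) => [x _|].
  exact: lmul_continuous.
exact: osub_open.
Qed.

Section Compact.
Hypothesis cG : compact [set: G].

(** The cosets form an open cover of a compact space; being disjoint, all of them occur in any
    finite subcover. *)
Lemma finite_cosets U : finite_set [set: cosets U].
Proof.
pose pG : ptopologicalType := HB.pack (G : Type)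
  (isPointed.Build (G : Type) (1%g : G)) (Topological.class G).
have : cover_compact [set: pG] by rewrite -compact_cover.
move=> /(_ (cosets U) setT (fun c => [set x | osub U ((repr c)^-1 * x)%g])) [].
- by move=> c _; apply: open_ltranslate.
- move=> x _; exists (\pi_(cosets U) x) => //=.
  by apply/cosetsP; rewrite reprK.
- move=> D _ DT; apply: (@sub_finite_set _ _ [set` D]); last exact: finite_fset.
  move=> c _; have [d /= dD] := DT (repr c) I.
  by move=> /cosetsP; rewrite !reprK => <-.
Qed.

Lemma finite_relcosets H V : finite_set [set: relcosets H V].
Proof.
pose f (c : relcosets H V) := \pi_(cosets V) (set_val (repr c)).
apply: (@sub_finite_set _ _ (f @^-1` [set: cosets V])) => //.
apply: finite_preimage (finite_cosets V) => c d _ _ /cosetsP.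
exact: relcosets_inj.
Qed.

(** A subgroup above [U] is a union of cosets of [U], hence determined by a subset [f V] of the
    finite set G/U. *)
Lemma finite_above U : finite_set [set V : openSubgroup G | U `<=` V].
Proof.
pose T := (fset_set [set: cosets U]).
pose f V := [fset c in T | `[< osub V (repr c) >]]%fset.
have fE V c : c \in f V = `[< osub V (repr c) >].
  by rewrite /f !inE /= in_fset_set ?in_setT //; apply: finite_cosets.
pose g s := xget U [set V : openSubgroup G | U `<=` V /\ f V = s].
apply: (@sub_finite_set _ _ (g @` [set` fpowerset T])).
  move=> V UV; exists (f V) => /=.
    by rewrite fpowersetE; apply/fsubsetP => c _; rewrite in_fset_set ?inE //; apply: finite_cosets.
  apply: xget_subset1 => // V1 W [UV1 E] [UW E']; rewrite -E' in E.
  have VW x : osub V1 x <-> osub W x.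
    suff H V' W' : U `<=` V' -> U `<=` W' -> f V' = f W' -> V' `<=` W'.
      by split; apply: H.
    have fP W0 y : U `<=` W0 -> osub W0 y <-> \pi_(cosets U) y \in f W0.
      move=> UW0; rewrite fE; have /UW0 W0y := repr_cosets U y.
      rewrite -[X in _ <-> `[< osub W0 X >]](tmulVKg y).
      by split=> [/(osubMr _ W0y) ?|/asboolP/(osubMr _ W0y)//]; apply/asboolP.
    by move=> UV' UW' E1 y; rewrite (fP _ _ UV') E1 -fP.
  by apply: osub_inj => x /VW.
by apply: finite_image; apply: finite_fset.
Qed.

(** The conjugate h^-1Uh depends only on the coset h^-1U, so finitely many conjugates occur. *)
Lemma finite_subconj H U :
  finite_set [set V : openSubgroup G | exists2 h, osub H h & conjos h^-1%g U `<=` V].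
Proof.
apply: (@sub_finite_set _ _
  (\bigcup_(c in [set: cosets U]) [set V : openSubgroup G | conjos (repr c) U `<=` V])).
  move=> V [h _ UV]; exists (\pi_(cosets U) h^-1%g) => //.
  have := repr_cosets U h^-1%g; set r := repr _ => Uhr.
  suff : conjos r U `<=` V by [].
  by rewrite -[r](tmulVKg h^-1%g) -conjosM [conjos (_ * _)%g U]conjos_id.
by apply: bigcup_finite => [|c _]; [apply: finite_cosets | apply: finite_above].
Qed.

(** The index of [U] in [G], the measure of the recursion onto L. It is constant on conjugacy
    classes and grows strictly when a subgroup shrinks. *)
Definition idx U : nat := #|` fset_set [set: cosets U]|.

Lemma idx_inj_le U V (f : cosets V -> cosets U) : injective f ->
  (idx V <= idx U)%N.
Proof.
move=> fI; have <- : #|` (f @` fset_set [set: cosets V])%fset| = idx V.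
  by rewrite card_imfset.
apply/fsubset_leq_card.
by apply/fsubsetP => c _; rewrite in_fset_set ?inE //; apply: finite_cosets.
Qed.

Lemma idx_conj g U : idx (conjos g U) = idx U.
Proof.
have H h W : (idx W <= idx (conjos h W))%N.
  apply: (@idx_inj_le _ _ (fun c => \pi_(cosets (conjos h W)) (repr c * h^-1)%g)).
  move=> c d /cosetsP; rewrite conjosE => Wcd.
  rewrite -[c]reprK -[d]reprK; apply/cosetsP.
  by move: Wcd; rewrite !tgroupE.
apply/eqP; rewrite eqn_leq H andbT.
by rewrite -{2}[U](conjosK g) H.
Qed.

Lemma idx_le U V : U `<=` V -> (idx V <= idx U)%N.
Proof.
move=> UV; apply: (@idx_inj_le _ _ (fun c => \pi_(cosets U) (repr c))).
move=> c d /cosetsP/UV Vcd; rewrite -[c]reprK -[d]reprK; exact/cosetsP.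
Qed.

Lemma idx_eq U V : U `<=` V -> idx U = idx V -> U = V.
Proof.
move=> UV E; apply: osub_inj => // x Vx; apply: contrapT => nUx.
pose f (c : cosets V) := \pi_(cosets U) (repr c).
have fI : injective f.
  by move=> c d /cosetsP/UV Vcd; rewrite -[c]reprK -[d]reprK; apply/cosetsP.
(* The coset [d] lies in the V-coset [c0] but differs from the one that [f] picks there, as [x] is
   not in [U]; so [f] misses it. *)
pose c0 := \pi_(cosets V) (1%g : G); pose d := \pi_(cosets U) (repr c0 * x)%g.
suff : (f @` fset_set [set: cosets V] `<` fset_set [set: cosets U])%fset.
  by move/fproper_ltn_card; rewrite card_imfset //= -/(idx V) -/(idx U) E ltnn.
rewrite fproperE; apply/andP; split.
  by apply/fsubsetP => c _; rewrite in_fset_set ?inE //; apply: finite_cosets.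
apply/negP => /fsubsetP/(_ d); rewrite in_fset_set ?inE; last exact: finite_cosets.
move=> /(_ I) /imfsetP[c /= _]; rewrite /d /f => /cosetsP Ucd.
have E' : c0 = c.
  rewrite -[c0]reprK -[c]reprK; apply/cosetsP.
  by move: (UV _ Ucd); rewrite !tgroupE => /osubMl; apply; apply: osubV.
by move: Ucd; rewrite -E' !tgroupE => /osubVE.
Qed.

End Compact.

(** Functions on G/U, kept on [G] so that translates and functions for different subgroups can be
    compared directly. *)
Definition rinv (D : Type) U (q : G -> D) := forall a u, osub U u -> q (a * u)%g = q a.

(** The stabilizer is open because it contains the open subgroup [U]. *)
Lemma stabilizer_ex (D : Type) H U (q : G -> D) : U `<=` H -> rinv U q ->
  exists V, forall h, osub V h <-> osub H h /\ forall a, q (a * h)%g = q a.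
Proof.
move=> UH Uq; pose P := [set h | osub H h /\ forall a, q (a * h)%g = q a].
have P1 : P 1%g by split=> [|a]; [apply: osub1 | rewrite tmulg1].
have PD x y : P x -> P y -> P (x^-1 * y)%g.
  move=> [Hx qx] [Hy qy]; split=> [|a]; first exact: osubD.
  by rewrite -tmulgA qy -[LHS]qx !tgroupE.
have Po : open P.
  rewrite openE => x [Hx qx].
  have : nbhs x [set y | osub U (x^-1 * y)%g].
    apply: open_nbhs_nbhs; split; first exact: open_ltranslate.
    by rewrite /= tmulVg; apply: osub1.
  apply: filterS => y /= Uxy; rewrite -[y](tmulVKg x); split=> [|a].
    by apply: osubM => //; apply: UH.
  by rewrite -tmulgA Uq // qx.
by exists (OpenSubgroup P1 PD Po).
Qed.

End Groups.

(** * Pure tensors and orbits *)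

Section TensorAction.
Variable G : topologicalGroupType.
Implicit Types (a b g h x y : G) (U V W H : openSubgroup G) (A : modObj).

Section Reindex.
Variables (A : modObj) (X Y : choiceType) (p : Y -> X).
Hypothesis bp : bijective p.

Lemma multilinear_reindex :
  multilinear idfun (fun m : X -> A => tpure (m \o p) : tens A Y).
Proof.
case: bp => q pK qK m' i a x y.
by rewrite !(dfwith_reindex _ _ _ pK qK) tpure_lin.
Qed.

Lemma tens_reindexD : {morph @tens_reindex A X Y p : t u / t + u}.
Proof. exact: (@tliftD _ _ _ _ _ idfun _ multilinear_reindex). Qed.

Lemma tens_reindexZ (a : mbase A) (t : tens A X) :
  tens_reindex p (a *: t) = a *: tens_reindex p t.
Proof. exact: (@tliftZ _ _ _ _ _ idfun _ multilinear_reindex). Qed.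

Lemma tens_reindex0 : @tens_reindex A X Y p 0 = 0.
Proof. by rewrite -[X in tens_reindex _ X](scale0r 0) tens_reindexZ scale0r. Qed.

End Reindex.

Lemma tens_act_bij g U :
  bijective (fun c : cosets U => \pi_(cosets (conjos g^-1%g U)) (repr c * g)%g).
Proof.
exists (fun c => \pi_(cosets U) (repr c * g^-1)%g) => c.
  rewrite -[RHS]reprK; apply/cosetsP.
  have := repr_cosets (conjos g^-1%g U) (repr c * g)%g.
  rewrite conjosE !tgroupE => /osubV; by rewrite !tgroupE.
rewrite -[RHS]reprK; apply/cosetsP; rewrite conjosE.
have := repr_cosets U (repr c * g^-1)%g.
by rewrite !tgroupE => /osubV; rewrite !tgroupE.
Qed.

Lemma tens_actD A g U : {morph @tens_act G A g (conjos g^-1%g U) U : t u / t + u}.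
Proof. exact: tens_reindexD (tens_act_bij g U). Qed.

Lemma tens_act0 A g U : @tens_act G A g (conjos g^-1%g U) U 0 = 0.
Proof. exact: tens_reindex0 (tens_act_bij g U). Qed.

(** For [q] in [rinv U] the factor at aU is [q a], whatever representative is taken. *)
Definition tfun A U (q : G -> A) : tens A (cosets U) :=
  tpure (fun c : cosets U => q (repr c)).

Lemma rinv_repr (D : Type) U (q : G -> D) a : rinv U q -> q (repr (\pi_(cosets U) a)) = q a.
Proof.
by move=> Uq; rewrite -[in RHS](Uq a _ (repr_cosets U a)) tmulVKg.
Qed.

Lemma rinv_conj (D : Type) h U (q : G -> D) :
  rinv (conjos h^-1%g U) q -> rinv U (fun a => q (a * h)%g).
Proof.
move=> Uq a u Uu; rewrite -(Uq (a * h)%g (h^-1 * u * h)%g) ?tgroupE //.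
by rewrite conjosE !tgroupE.
Qed.

Lemma tens_act_tfun A h U (q : G -> A) : rinv (conjos h^-1%g U) q ->
  tens_act h (tfun (conjos h^-1%g U) q) = tfun U (fun a => q (a * h)%g).
Proof.
move=> Uq; rewrite [LHS]tens_reindex_pure; last exact: tens_act_bij.
by congr tpure; apply/funext => c; rewrite /= rinv_repr.
Qed.

Section Tau.
Variables (H : openSubgroup G) (S : set (openSubgroup G)) (A : modObj).

(* the contribution to the ghost map of the pure tensor with factor q a at aV *)
Definition tau V (q : G -> A) : tprod S A := fun U : set_type S =>
  \sum_(c \in @fixed_cosets G H (set_val U) V)
    tfun (set_val U) (fun a => q (a * set_val (repr c))%g).

Definition translates (D : Type) (f : G -> D) : set (G -> D) :=
  [set f' | exists2 h, osub H h & f' = fun a => f (a * h)%g].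

Definition is_stab (D : Type) (f : G -> D) V :=
  forall h, osub V h <-> osub H h /\ forall a, f (a * h)%g = f a.

Lemma is_stab_rinv (D : Type) (f : G -> D) V : is_stab f V -> rinv V f.
Proof. by move=> sV a u /sV[]. Qed.

Lemma is_stab_uniq (D : Type) (f : G -> D) V W : is_stab f V -> is_stab f W -> V = W.
Proof.
by move=> sV sW; apply: osub_inj => h; [move/sV/sW | move/sW/sV].
Qed.

(** Matching hV with the translate of [f] by h identifies H/V with the orbit of [f]; the points
    fixed by [U] are the right U-invariant translates. *)
Lemma fixed_cosets_stab (D : Type) (f : G -> D) V U (c : relcosets H V) :
  U `<=` H -> is_stab f V ->
  fixed_cosets U c <-> rinv U (fun a => f (a * set_val (repr c))%g).
Proof.
move=> UH sV; have Hc := relcosets_mem c; rewrite /fixed_cosets /mkset.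
move: (set_val (repr c)) Hc => h Hh; split=> [UV|Uf].
  by apply: rinv_conj => a u /UV /sV[].
move=> x; rewrite conjosE tinvgK => Ux; apply/sV; split=> [|a].
  have /UH := Ux; rewrite tmulgA => /(osubMl _ Hh).
  by move/(osubMr _ (osubV Hh)).
by have := Uf (a * h^-1)%g _ Ux; rewrite !tgroupE.
Qed.

Hypothesis SH : forall U, S U -> U `<=` H.

(* an H-orbit of functions on G is isomorphic to H/V, for V the stabilizer *)
Lemma tau_orbit (D : choiceType) (f : G -> D) (beta : D -> A) V (U : set_type S) :
  is_stab f V ->
  tau V (beta \o f) U =
  \sum_(f' \in translates f `&` rinv (set_val U)) tfun (set_val U) (beta \o f').
Proof.
move=> sV; have UH : set_val U `<=` H by apply: SH; apply: set_valP.
apply/esym/(@reindex_fsbig _ _ _ _ _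
  (fun (c : relcosets H V) a => f (a * set_val (repr c))%g)); split.
- move=> c /= /(fixed_cosets_stab c UH sV) Uc; split=> //.
  by exists (set_val (repr c)) => //; apply: relcosets_mem.
- move=> c d _ _ E; apply: relcosets_inj; apply/sV; split=> [|a].
    by apply: osubD; apply: relcosets_mem.
  have := congr1 (fun q => q (a * (set_val (repr c))^-1)%g) E.
  by rewrite !tgroupE => ->.
- move=> f' [[h Hh ->] Uf']; have [c Vc] := relcosets_ex V Hh.
  have E : (fun a => f (a * set_val (repr c))%g) = (fun a => f (a * h)%g).
    apply/funext => a; have /sV[_ /(_ (a * set_val (repr c))%g)] := Vc.
    by rewrite !tgroupE.
  by exists c => //; apply/(fixed_cosets_stab c UH sV); rewrite E.
Qed.

End Tau.
End TensorAction.
Arguments tau {G} H S {A} V q U.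

(** * Locally finite combinations and orbit decompositions *)

Section LocallyFiniteSpan.
Variable G : topologicalGroupType.
Hypothesis cG : compact [set: G].
Variables (H : openSubgroup G) (S : set (openSubgroup G)) (A : modObj).
Hypothesis hS : truncation_set H S.
Implicit Types (U V W : openSubgroup G).

Let SH U : S U -> U `<=` H. Proof. by case: hS => + _ _; apply. Qed.
Let SU U V : S U -> U `<=` V -> V `<=` H -> S V.
Proof. by case: hS => _ _; apply. Qed.
Let SJ h U : osub H h -> S U -> S (conjos h U).
Proof. by case: hS => _ + _; apply. Qed.

(** Equivalently, (H/V)^U is not empty: the condition for [V] to contribute to the U-component. *)
Definition subconj U V := exists2 h, osub H h & conjos h^-1%g U `<=` V.

Lemma finite_subconj_in U (B : set (openSubgroup G)) :
  finite_set (B `&` [set V | subconj U V]).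
Proof. by apply: finite_setIr; apply: finite_subconj. Qed.

Lemma subconj_trans U V W : subconj U V -> subconj V W -> subconj U W.
Proof.
move=> [h Hh UV] [g Hg VW]; exists (h * g)%g; first exact: osubM.
by rewrite tinvgM -conjosM; move=> x /(conjosS UV)/VW.
Qed.

Lemma subconj_idx U V : subconj U V -> (idx V <= idx U)%N.
Proof. by move=> [h _ /(idx_le cG)]; rewrite idx_conj. Qed.

Definition taus V : set (tprod S A) :=
  [set x | exists2 q, rinv V q & x = tau H S V q].

Lemma zspan_taus_eq0 V x (U : set_type S) :
  x \in zspan (taus V) -> ~ subconj (set_val U) V -> x U = 0.
Proof.
move=> /asboolP/(_ (fun x => `[< ~ subconj (set_val U) V -> x U = 0 >])) E nUV.
have : `[< ~ subconj (set_val U) V -> x U = 0 >]; last by move/asboolP; apply.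
apply: E => [|_ [q _ ->]].
  split=> [|y z /asboolP y0 /asboolP z0]; apply/asboolP => // n.
  by rewrite -[(y - z) U]/(y U - z U) y0 // z0 // subr0.
apply/asboolP => n; rewrite /tau fsbig1 // => c Uc; case: n.
by exists (set_val (repr c)) => //; apply: relcosets_mem.
Qed.

(* Locally finite integral combinations of the tau V q with V in P. Without the
   choices behind the ghost map, they make up its image: see [free_wittE]. *)
Definition locspan (P : set (openSubgroup G)) (x : tprod S A) := exists y,
  [/\ forall V, y V \in zspan (taus V), forall V, ~ P V -> y V = 0 &
      forall U : set_type S, x U = \sum_(V \in S) y V U].

(** Cuts a sum over possibly infinitely many subgroups down to a finite index set that depends on
    [U] only, where sums can be added and exchanged. *)
Lemma fsbig_above (y : openSubgroup G -> tprod S A) (U : set_type S)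
    (B : set (openSubgroup G)) :
  (forall V, y V \in zspan (taus V)) ->
  \sum_(V \in B) y V U = \sum_(V \in B `&` [set V | subconj (set_val U) V]) y V U.
Proof.
move=> yT; apply/esym/fsbig_widen => [V []//|V [BV nV]].
by apply: zspan_taus_eq0 => // ?; apply: nV.
Qed.

Lemma locspanB P x x' : locspan P x -> locspan P x' -> locspan P (x - x').
Proof.
move=> [y [yT yP yE]] [y' [yT' yP' yE']]; exists (fun V => y V - y' V).
split=> [V|V nP|U]; first exact: rpredB.
  by rewrite yP // yP' // subr0.
have yT'' V : y V - y' V \in zspan (taus V) by exact: rpredB.
rewrite (fsbig_above U S yT'').
rewrite -[(x - x') U]/(x U - x' U) yE yE' (fsbig_above U S yT) (fsbig_above U S yT').
by rewrite !fsbig_finite -?sumrB //; apply: finite_subconj_in.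
Qed.

Lemma locspan0 P : locspan P 0.
Proof.
exists (fun=> 0); split=> [V|//|U]; first exact: rpred0.
by rewrite fsbig1.
Qed.

Lemma locspanD P x x' : locspan P x -> locspan P x' -> locspan P (x + x').
Proof.
move=> Px Px'; rewrite -[x']opprK -[- x']sub0r; apply: locspanB => //.
by apply: locspanB => //; apply: locspan0.
Qed.

Lemma locspanS (P Q : set (openSubgroup G)) x :
  P `<=` Q -> locspan P x -> locspan Q x.
Proof.
by move=> PQ [y [yT yP yE]]; exists y; split=> // V nQ; apply: yP => /PQ.
Qed.

Lemma locspan_zspan V x : S V -> x \in zspan (taus V) -> locspan [set V] x.
Proof.
move=> SV xT; exists (fun W => if W == V then x else 0); split=> [W|W nW|U].
- by case: eqP => [->//|_]; apply: rpred0.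
- by case: eqP nW => // ->; case.
- rewrite -(@fsbig_widen _ _ _ _ [set V]) ?fsbig_set1 ?eqxx //.
    by move=> _ ->.
  by move=> W [_ /= /eqP/negbTE ->].
Qed.

Lemma fsbig_tprodE (I : choiceType) (B : set I) (y : I -> tprod S A) (U : set_type S) :
  finite_set B -> (\sum_(i \in B) y i) U = \sum_(i \in B) y i U.
Proof. by move=> fB; apply: (@fsbig_morph _ _ _ (fun x : tprod S A => x U)). Qed.

(** The coefficient at W collects those of all [x V] at W. The condition [subconj W V] leaves
    finitely many V for each W, so this is again an integral combination; componentwise the two sums
    are finite and are exchanged. *)
Lemma locspan_sum (B : set (openSubgroup G)) (P : openSubgroup G -> set (openSubgroup G))
    (x : openSubgroup G -> tprod S A) Q :
  (forall V, B V -> locspan (P V) (x V)) ->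
  (forall V W, B V -> P V W -> subconj W V /\ Q W) ->
  locspan Q (fun U : set_type S => \sum_(V \in B) x V U).
Proof.
move=> xP PQ.
have /choice[z zP] V : exists z, B V ->
    [/\ forall W, z W \in zspan (taus W), forall W, ~ P V W -> z W = 0 &
        forall U : set_type S, x V U = \sum_(W \in S) z W U].
  by have [/xP[z ?]|] := pselect (B V); [exists z | exists (fun=> 0)].
pose BW W := B `&` [set V | subconj W V].
have fBW W : finite_set (BW W) by apply: finite_subconj_in.
have zT V W : B V -> z V W \in zspan (taus W) by move=> /zP[+ _ _]; apply.
have z0 V W : B V -> ~ P V W -> z V W = 0 by move=> /zP[_ + _]; apply.
have zsumT W : \sum_(V \in BW W) z V W \in zspan (taus W).
  rewrite fsbig_finite //; rewrite big_seq; apply: rpred_sum => V.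
  by rewrite in_fset_set // => /set_mem[BV _]; apply: zT.
exists (fun W => \sum_(V \in BW W) z V W); split=> // [W nQ|U].
- by apply: fsbig1 => V [BV _]; apply: z0 => // /(PQ _ _ BV)[].
rewrite (fsbig_above U S zsumT).
set T := S `&` _; have fT : finite_set T by apply: finite_subconj_in.
pose BU := BW (set_val U).
have xE V : B V -> x V U = \sum_(W \in T) z V W U.
  by move=> BV; have [_ _ ->] := zP _ BV; rewrite fsbig_above // => W; apply: zT.
rewrite -(@fsbig_widen _ _ _ _ BU) => [||V [BV nV]]; first last.
- rewrite /= xE // fsbig1 // => W [SW UW]; have [PVW|nP] := pselect (P V W).
    case: nV; split=> //; apply: subconj_trans UW _.
    by have [] := PQ _ _ BV PVW.
  by rewrite z0.
- by move=> V [].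
transitivity (\sum_(V \in BU) \sum_(W \in T) z V W U).
  by refine (@eq_fsbigr _ _ _ _ _ _ _ _) => V /set_mem[BV _]; apply: xE.
transitivity (\sum_(W \in T) \sum_(V \in BU) z V W U).
  by apply: exchange_fsbig => //; apply: fBW.
refine (@eq_fsbigr _ _ _ _ _ _ _ _) => W /set_mem[SW UW].
rewrite fsbig_tprodE //; apply/esym/fsbig_widen => V.
  by move=> [BV WV]; split=> //; apply: subconj_trans UW WV.
move=> [[BV UV] nV] /=; rewrite z0 // => PVW; apply: nV; split=> //.
by have [] := PQ _ _ BV PVW.
Qed.

Section Orbits.
Variables (D : choiceType) (X : set (G -> D)) (beta : D -> A).
Hypothesis XH : forall f h, osub H h -> X f -> X (fun a => f (a * h)%g).
Hypothesis Xfin : forall U, S U -> finite_set (X `&` rinv U).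

Let rep (f : G -> D) : G -> D := xget f (translates H f).

Let repP f : translates H f (rep f).
Proof.
apply: (@xgetI _ f _ f); exists 1%g; first exact: osub1.
by apply/funext => a; rewrite tmulg1.
Qed.

Let translates_eq (f f' : G -> D) :
  translates H f f' -> translates H f' = translates H f.
Proof.
move=> [h Hh ->]; apply/seteqP; split=> _ [g Hg ->].
  exists (g * h)%g; first exact: osubM.
  by apply/funext => a; rewrite !tgroupE.
exists (g * h^-1)%g; first by apply: osubM => //; apply: osubV.
by apply/funext => a; rewrite !tgroupE.
Qed.

Let rep_sym f : translates H (rep f) f.
Proof.
rewrite (translates_eq (repP f)); exists 1%g; first exact: osub1.
by apply/funext => a; rewrite tmulg1.
Qed.

(** The defaults given to [xget] differ, but the two sets of translates are equal and nonempty, so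
    the choice is the same. *)
Let rep_eq f f' : translates H f f' -> rep f' = rep f.
Proof.
move=> ff'; rewrite /rep (translates_eq ff') /xget.
by case: pselect => // -[]; exists f'; apply/asboolP.
Qed.

Let X_translates f f' : translates H f f' -> X f -> X f'.
Proof. by move=> [h Hh ->]; apply: XH. Qed.

(** The translate by h is invariant under hUh^-1. This group is in [S] by closure under conjugation,
    and the stabilizer above it by upward closure. *)
Let stab_ex (f f' : G -> D) U : S U -> rinv U f -> translates H f f' ->
  exists V, [/\ is_stab H f' V, S V & subconj U V].
Proof.
move=> SU' Uf [h Hh ->].
have Uf' : rinv (conjos h U) (fun a => f (a * h)%g).
  by apply: rinv_conj; rewrite conjosK.
have UH : conjos h U `<=` H by apply/SH/SJ.
have [V sV] := stabilizer_ex UH Uf'; exists V; split=> //.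
  apply: (SU (SJ Hh SU')) => x; last by move=> /sV[].
  by move=> Ux; apply/sV; split; [apply: UH | move=> a; apply: Uf'].
exists h^-1%g; first exact: osubV.
rewrite tinvgK => x Ux; apply/sV; split; first exact: UH.
by move=> a; apply: Uf'.
Qed.

(** By [tau_orbit] each orbit contributes [tau] at the stabilizer of its representative. The
    coefficient at V gathers the representatives with stabilizer V; they are V-invariant, hence
    finitely many. *)
Lemma orbit_decomposition :
  locspan [set V | exists2 f, X f & is_stab H f V]
    (fun U : set_type S =>
      \sum_(f \in X `&` rinv (set_val U)) tfun (set_val U) (beta \o f)).
Proof.
pose R V := [set f : G -> D | [/\ X f, rep f = f & is_stab H f V]].
have fR V : S V -> finite_set (R V).
  move=> SV; apply: sub_finite_set (Xfin SV) => f [Xf _ sV].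
  by split=> //; apply: is_stab_rinv sV.
pose y V : tprod S A :=
  if `[< S V >] then \sum_(f \in R V) tau H S V (beta \o f) else 0.
have yT V : y V \in zspan (taus V).
  rewrite /y; case: asboolP => [SV|_]; last exact: rpred0.
  rewrite fsbig_finite ?big_seq; last exact: fR.
  apply: rpred_sum => f; rewrite in_fset_set; last exact: fR.
  move=> /set_mem[_ _ sV]; apply: mem_zspan; exists (beta \o f) => // a u Vu.
  by rewrite /= (is_stab_rinv sV).
exists y; split=> // [V nV|U].
  rewrite /y; case: asboolP => // _; apply: fsbig1 => f [Xf _ sV].
  by case: nV; exists f.
have SU' : S (set_val U) by apply: set_valP.
have fXU := Xfin SU'; set XU := X `&` _ in fXU *.
have fB : finite_set (rep @` XU) by apply: finite_image.
pose st (f : G -> D) := xget (set_val U) [set V | is_stab H f V].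
have stE (f : G -> D) V : is_stab H f V -> st f = V.
  by move=> sV; apply: xget_unique => // W sW; apply: is_stab_uniq sW sV.
have BP f : (rep @` XU) f ->
    [/\ X f, rep f = f, is_stab H f (st f), S (st f) & subconj (set_val U) (st f)].
  move=> [f' [Xf' Uf'] <-]; have [V [sV SV UV]] := stab_ex SU' Uf' (repP f').
  rewrite (stE _ _ sV); split=> //; first exact: X_translates (repP f') Xf'.
  exact: rep_eq (repP f').
rewrite (fsbig_above U S yT); set C := S `&` _.
have fC : finite_set C by apply: finite_subconj_in.
transitivity (\sum_(f \in rep @` XU) tau H S (st f) (beta \o f) U).
  rewrite (@fsbig_partition _ _ _ _ (rep @` XU) rep) //.
  refine (@eq_fsbigr _ _ _ _ _ _ _ _) => f /set_mem /BP[Xf rf sf _ _].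
  apply: etrans (esym (tau_orbit SH beta U sf)); apply: eq_fsbigl.
  apply/seteqP; split=> f'.
    by move=> [[Xf' Uf'] <-]; split=> //; apply: rep_sym.
  move=> [ff' Uf']; split; last by rewrite /= (rep_eq ff').
  by split=> //; apply: X_translates ff' Xf.
rewrite (@fsbig_partition _ _ _ _ C st) // => [|f /BP[]//].
refine (@eq_fsbigr _ _ _ _ _ _ _ _) => V /set_mem[SV _].
rewrite /y asboolT // fsbig_tprodE; last exact: fR.
transitivity (\sum_(f \in (rep @` XU) `&` st @^-1` [set V]) tau H S V (beta \o f) U).
  by refine (@eq_fsbigr _ _ _ _ _ _ _ _) => f /set_mem[_ <-].
apply: fsbig_widen => [f [/BP[Xf rf sf _ _] <-]//|f [[Xf rf sf] nf]].
apply: (etrans (tau_orbit SH beta U sf)); apply: fsbig1 => f' [ff' Uf'].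
case: nf; split; last exact: stE.
exists f'; last by rewrite (rep_eq ff').
by split=> //; apply: X_translates ff' Xf.
Qed.

End Orbits.
End LocallyFiniteSpan.
Arguments taus {G} H S A V.

(** * The ghost map of a sum of pure tensors *)

Section CosetSplit.
Variables (G : topologicalGroupType) (V U : openSubgroup G) (r : cosets V -> G).
Hypotheses (rK : cancel r \pi_(cosets V)) (UV : U `<=` V).
Implicit Types x y : G.

(** The factor v in the decomposition x = g v, with g the chosen representative of xV and v in
    [V]. *)
Definition residue x : G := ((r (\pi_(cosets V) x))^-1 * x)%g.

Lemma residue_mem x : osub V (residue x).
Proof. by apply/cosetsP; rewrite rK. Qed.

Lemma residueM x v : osub V v -> residue (x * v)%g = (residue x * v)%g.
Proof.
move=> Vv; rewrite /residue tmulgA; congr ((r _)^-1 * _)%g.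
by apply/cosetsP; rewrite !tgroupE; apply: osubV.
Qed.

Lemma coset_split1 x : (coset_split (U := U) rK (\pi_(cosets U) x)).1 = \pi_(cosets V) x.
Proof. by apply/esym/cosetsP/UV/repr_cosets. Qed.

(** [coset_split] reads the representative of xU rather than x; since [U] lies in [V], this changes
    the residue by a right factor in [U] only. *)
Lemma coset_split2 x y :
  (coset_split (U := U) rK (\pi_(cosets U) x)).2 =
  (coset_split (U := U) rK (\pi_(cosets U) y)).2 <->
  osub U ((residue x)^-1 * residue y)%g.
Proof.
have E z : exists2 u, osub U u & residue (repr (\pi_(cosets U) z)) = (residue z * u)%g.
  have Uz := repr_cosets U z; exists (z^-1 * repr (\pi_(cosets U) z))%g => //.
  by rewrite -residueM ?tmulVKg //; apply: UV.
have [u Uu xE] := E x; have [w Uw yE] := E y.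
have -> : osub U ((residue x)^-1 * residue y)%g <->
    osub U ((residue (repr (\pi_(cosets U) x)))^-1 *
            residue (repr (\pi_(cosets U) y)))%g.
  rewrite xE yE; move: (residue x) (residue y) => a b; rewrite !tgroupE.
  have UVu := osubV Uu.
  have -> : (u^-1 * (a^-1 * (b * w)) = u^-1 * (a^-1 * b * w))%g by rewrite !tgroupE.
  split=> [Uxy|/(osubMl _ UVu)/(osubMr _ Uw)//].
  by apply/(osubMl _ UVu)/(osubMr _ Uw).
split=> [/lcosetsP/asboolP //|Uxy]; apply/lcosetsP/asboolP.
exact: Uxy.
Qed.

Lemma coset_split_surj c (z : relcosets V U) :
  exists x, coset_split rK (\pi_(cosets U) x) = (c, z).
Proof.
exists (repr (coset_join r (c, z))); rewrite reprK.
exact: coset_joinK.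
Qed.

End CosetSplit.

Section PureSums.
Variable G : topologicalGroupType.
Hypothesis cG : compact [set: G].
Variables (H : openSubgroup G) (S : set (openSubgroup G)).
Hypothesis hS : truncation_set H S.
Variables (ch : ghostChoice H S) (A : modObj).
Implicit Types (U W : openSubgroup G).

Definition ghost_summand V (n : tens A (cosets V)) : tprod S A :=
  fun U : set_type S => \sum_(c \in @fixed_cosets G H (set_val U) V)
    ghost_term ch (set_val U) (set_val (repr c)) n.

Variables (V : openSubgroup G) (k : nat).
Hypothesis SV : S V.
Let D : choiceType := ('I_k.+1 * cosets V)%type.
Let r := @crep _ _ _ ch V.
Let rK : cancel r \pi_(cosets V) := @crepK _ _ _ ch V.

Definition selection U h (phi : relcosets V (conjos h^-1%g U) -> 'I_k.+1) : G -> D :=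
  fun a => let s := coset_split rK (\pi_(cosets (conjos h^-1%g U)) (a * h)%g) in
  (phi s.2, s.1).

(** The expanded power has one pure tensor for each [phi], and the two reindexings turn its factor
    at aU into the vector labelled by [selection phi a]. *)
Lemma ghost_term_sum (p : 'I_k.+1 -> cosets V -> A) U h :
  conjos h^-1%g U `<=` V ->
  ghost_term ch U h (\sum_i tpure (p i)) =
  \sum_(phi \in [set: relcosets V (conjos h^-1%g U) -> 'I_k.+1])
    tfun U ((fun x : D => p x.1 x.2) \o selection phi).
Proof.
move=> UV; have finZ := finite_relcosets cG V (conjos h^-1%g U).
have bs : bijective (@coset_split _ V (conjos h^-1%g U) r rK).
  by exists (coset_join r); [apply: coset_splitK | apply: coset_joinK].
rewrite /ghost_term tens_pow_sum // /coset_tens.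
have finF := @finite_ord_fun _ k finZ.
rewrite (fsbig_morph _ (tens_reindex0 A bs) (tens_reindexD (A := A) bs)) //.
rewrite (fsbig_morph _ (tens_act0 A h U) (@tens_actD _ A h U)) //.
refine (@eq_fsbigr _ _ _ _ _ _ _ _) => phi _.
rewrite tens_reindex_pure // /tens_act tens_reindex_pure //.
exact: tens_act_bij.
Qed.

(* The H-set H x_V Map(V, I) of which the ghost map of a sum of #|I| pure
   tensors counts the orbits: the class of (h, phi) is encoded as the function
   a |-> (phi (residue of ah), ahV), on which H acts by right translation. *)
Definition selections : set (G -> D) := [set f | exists2 h, osub H h &
  (forall a, (f a).2 = \pi_(cosets V) (a * h)%g) /\
  forall a b, residue r (a * h)%g = residue r (b * h)%g -> (f a).1 = (f b).1].

Lemma selections_translate f h : osub H h -> selections f ->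
  selections (fun a => f (a * h)%g).
Proof.
move=> Hh [g Hg [f2 f1]]; exists (h * g)%g; first exact: osubM.
split=> [a|a b]; first by rewrite f2 tmulgA.
by rewrite -!tmulgA; apply: f1.
Qed.

(** Describes the U-fixed points over one coset hV: fixing by [U] means that the map on [V] descends
    to V/h^-1Uh. *)
Lemma selection_bij U (c : relcosets H V) : fixed_cosets U c ->
  set_bij setT (selections `&` rinv U `&`
      [set f | (f 1%g).2 = \pi_(cosets V) (set_val (repr c))])
    (@selection U (set_val (repr c))).
Proof.
have := relcosets_mem c; rewrite /fixed_cosets /mkset.
move: (set_val (repr c)) => h Hh UV; have S1 := coset_split1 rK UV.
split=> [phi _|phi psi _ _ E|f [[[g Hg [f2 f1]] Uf] f2h]].
- split; [split|].
  + exists h => //; split=> [a|a b ab]; first exact: S1.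
    apply: (congr1 phi); apply/coset_split2 => //.
    by rewrite ab tmulVg; apply: osub1.
  + move=> a u Uu; rewrite /selection /=; suff -> :
      \pi_(cosets (conjos h^-1%g U)) (a * u * h)%g =
      \pi_(cosets (conjos h^-1%g U)) (a * h)%g by [].
    by apply/cosetsP; rewrite conjosE !tgroupE; apply: osubV.
  + by apply: etrans (S1 _) _; rewrite tmul1g.
- apply/funext => z; have [x xE] := coset_split_surj rK UV (\pi_(cosets V) 1%g) z.
  have := congr1 (fun f => (f (x * h^-1)%g).1) E.
  by rewrite /selection !tgroupE xE.
(* The witness [g] need not be [h], but gV = hV, and right multiplication by an element of [V]
   preserves equality of residues. So both clauses hold for [h] as well. *)
- have Vgh : osub V (g^-1 * h)%g by apply/cosetsP; rewrite -f2h f2 tmul1g.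
  have {f2h}f2 a : (f a).2 = \pi_(cosets V) (a * h)%g.
    by rewrite f2; apply/cosetsP; rewrite !tgroupE.
  have {}f1 a b : residue r (a * h)%g = residue r (b * h)%g -> (f a).1 = (f b).1.
    move=> ab; apply: f1; have E x : (x * g = x * h * (g^-1 * h)^-1)%g.
      by rewrite !tgroupE.
    by have VV := osubV Vgh; rewrite !E !(residueM r _ VV) ab.
  (* A point of [V] whose residue has class [z]; the map on V/h^-1Uh is read off [f] at these
     points. *)
  pose y z := sval (cid (coset_split_surj rK UV (\pi_(cosets V) 1%g) z)).
  have yE z : coset_split rK (\pi_(cosets (conjos h^-1%g U)) (y z)) =
      (\pi_(cosets V) 1%g, z) by rewrite /y; case: cid.
  exists (fun z => (f (y z * h^-1)%g).1) => //; apply/funext => a.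
  rewrite /selection S1 -f2 [RHS]surjective_pairing; congr (_, _).
  set z := (coset_split _ _).2.
  have : (coset_split rK (\pi_(cosets (conjos h^-1%g U)) (a * h)%g)).2 =
      (coset_split rK (\pi_(cosets (conjos h^-1%g U)) (y z))).2 by rewrite yE.
  (* Here w, in h^-1Uh, carries the residue of ah to that of the sample point; moving a by hwh^-1,
     in [U], leaves [f] unchanged and makes the residues equal. *)
  move/(coset_split2 _ UV); set w := (_ * _)%g => Uw.
  have Vw : osub V w by apply: (UV w).
  have Uw' : osub U (h * w * h^-1)%g by move: Uw; rewrite conjosE tinvgK.
  rewrite -(Uf a _ Uw'); apply: f1.
  have E (x : G) : (a * (h * x * h^-1) * h = a * h * x)%g by rewrite !tgroupE.
  by rewrite E [RHS](residueM r _ Vw) /w tmulVKg tmulgA tmulVg tmulg1.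
Qed.

Let SH U : S U -> U `<=` H. Proof. by case: hS => + _ _; apply. Qed.

Lemma is_stab_cosets : is_stab H \pi_(cosets V) V.
Proof.
move=> v; split=> [Vv|[_ /(_ 1%g)]].
  split; first exact: (SH SV).
  by move=> a; apply/cosetsP; rewrite !tgroupE; apply: osubV.
by rewrite tmul1g => /cosetsP; rewrite tmulg1 => /osubVE.
Qed.

(** Projection to H/V is equivariant, so a U-fixed point lies over a U-fixed coset. *)
Lemma selections_rinv U f : S U -> (selections `&` rinv U) f ->
  exists2 c : relcosets H V, fixed_cosets U c &
    forall a, (f a).2 = \pi_(cosets V) (a * set_val (repr c))%g.
Proof.
move=> SU [[h Hh [f2 _]] Uf]; have [c Vc] := relcosets_ex V Hh.
have f2c a : (f a).2 = \pi_(cosets V) (a * set_val (repr c))%g.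
  rewrite f2; apply/cosetsP; have := osubV Vc.
  by rewrite !tgroupE.
exists c => //; apply/(fixed_cosets_stab _ (SH SU) is_stab_cosets) => a u Uu.
by rewrite -!f2c Uf.
Qed.

Lemma finite_selections U : S U -> finite_set (selections `&` rinv U).
Proof.
move=> SU; apply: (@sub_finite_set _ _ (\bigcup_(c in @fixed_cosets _ H U V)
    ((@selection U (set_val (repr c))) @` setT))).
  move=> f Ef; have [c Uc f2] := selections_rinv SU Ef.
  have [_ _ /(_ f)[]] := selection_bij Uc; last by move=> phi _ <-; exists c.
  by split; rewrite // /mkset f2 tmul1g.
apply: bigcup_finite => [|c _].
  by apply: sub_finite_set (finite_relcosets cG H V).
by apply: finite_image; apply: finite_ord_fun; apply: finite_relcosets.
Qed.

(** The double sum over hV in (H/V)^U and over [phi] is the sum over U-fixed points, fibred over H/V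
    by the value at 1. *)
Lemma ghost_summand_sum (p : 'I_k.+1 -> cosets V -> A) (U : set_type S) :
  ghost_summand (\sum_i tpure (p i)) U =
  \sum_(f \in selections `&` rinv (set_val U))
    tfun (set_val U) ((fun x : D => p x.1 x.2) \o f).
Proof.
have SU : S (set_val U) by apply: set_valP.
have fE := finite_selections SU.
have [c0 _] := relcosets_ex V (osub1 H).
pose g (f : G -> D) : relcosets H V :=
  xget c0 [set c | (f 1%g).2 = \pi_(cosets V) (set_val (repr c))].
have gE f c : (f 1%g).2 = \pi_(cosets V) (set_val (repr c)) -> g f = c.
  move=> fc; apply: xget_unique => // d /=; rewrite fc => /cosetsP Vcd.
  by apply/esym/relcosets_inj.
rewrite [RHS](@fsbig_partition _ _ _ _ (@fixed_cosets _ H (set_val U) V) g) //.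
- refine (@eq_fsbigr _ _ _ _ _ _ _ _) => c /set_mem Uc.
  rewrite ghost_term_sum //.
  transitivity (\sum_(f \in selections `&` rinv (set_val U) `&`
      [set f | (f 1%g).2 = \pi_(cosets V) (set_val (repr c))])
    tfun (set_val U) ((fun x : D => p x.1 x.2) \o f)).
    exact: (esym (reindex_fsbig _ _ _ _ (selection_bij Uc))).
  apply: eq_fsbigl; apply/seteqP; split=> f [Ef fc]; split=> //; first exact: gE.
  have [d _ f2] := selections_rinv SU Ef.
  by have := f2 1%g; rewrite tmul1g => E; rewrite /mkset E -(gE _ _ E) fc.
- by apply: sub_finite_set (finite_relcosets cG H V).
- move=> f /(selections_rinv SU)[c Uc f2].
  by rewrite (gE f c) // f2 tmul1g.
Qed.

(** Where the non-constant selections contribute; the strict inequality drives the recursion. *)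
Definition below : set (openSubgroup G) :=
  [set W | subconj H W V /\ (idx V < idx W)%N].

Lemma ghost_summand_pures (p : 'I_k.+1 -> cosets V -> A) :
  locspan H below (ghost_summand (\sum_i tpure (p i)) -
    \sum_i tau H S V (p i \o \pi_(cosets V))).
Proof.
pose C := [set f : G -> D | exists i, forall a, (f a).1 = i].
pose beta (x : D) := p x.1 x.2.
have := @orbit_decomposition _ cG H S A hS D (selections `&` ~` C) beta.
case=> [f h Hh [Ef nC]|U SU|y [yT y0 yE]].
- split; first exact: selections_translate.
  move=> [i fi]; apply: nC; exists i => a.
  by rewrite -(fi (a * h^-1)%g) !tgroupE.
- by apply: sub_finite_set (finite_selections SU) => f [[]].
exists y; split=> // [W nW|U].
  apply: y0 => -[f [[h Hh [f2 f1]] nC] sW]; apply: nW.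
  have WV : conjos h^-1%g W `<=` V.
    move=> x; rewrite conjosE tinvgK => /sW[_ /(_ h^-1%g) E].
    have := congr1 snd E; rewrite !f2 !tgroupE => /cosetsP.
    by rewrite tmulg1 => /osubVE.
  split; first by exists h.
  rewrite ltn_neqAle -(idx_conj cG h^-1%g W) (idx_le cG WV) andbT.
  (* With equal indices the stabilizer would be all of hVh^-1. As [V] acts transitively on residues,
     the label would then be constant, contrary to [nC]. *)
  apply/negP => /eqP E; have {}E := idx_eq cG WV (esym E).
  apply: nC; exists (f 1%g).1 => a; apply/esym.
  pose v := ((residue r (1 * h))^-1 * residue r (a * h))%g.
  have Vv : osub V v by apply: osubD; apply: residue_mem.
  have /sW[_ fW] : osub W (h * v * h^-1)%g.
    by move: Vv; rewrite -E conjosE tinvgK.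
  rewrite -(fW 1%g); apply: f1.
  have E1 (x : G) : (1 * (h * x * h^-1) * h = 1 * h * x)%g by rewrite !tgroupE.
  by rewrite E1 (residueM r _ Vv) /v tmulVKg.
rewrite -yE; apply/eqP; rewrite -[X in X == _]/(_ U - _ U) subr_eq; apply/eqP.
have SU : S (set_val U) by apply: set_valP.
have fE := finite_selections SU.
rewrite ghost_summand_sum (fsbigID C) // addrC.
congr (_ + _); last by rewrite setIAC.
(* The selections with constant label i form one copy of the orbit of G -> G/V, whose stabilizer is
   [V]. *)
rewrite (@fsbig_partition _ _ _ _ [set: 'I_k.+1]
  (fun f : G -> D => (f 1%g).1)) //; last 2 first.
- exact: finite_setIl.
- exact: finite_finset.
have -> : (\sum_i tau H S V (p i \o \pi_(cosets V))) U =
    \sum_i tau H S V (p i \o \pi_(cosets V)) U.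
  exact: (big_morph (fun x : tprod S A => x U)).
have sumT (F : 'I_k.+1 -> tens A (cosets (set_val U))) :
    \sum_i F i = \sum_(i \in [set: 'I_k.+1]) F i.
  rewrite -big_enum fsbig_seq ?enum_uniq //; apply: eq_fsbigl.
  by apply/seteqP; split=> // i _; rewrite /= mem_enum.
rewrite sumT; refine (@eq_fsbigr _ _ _ _ _ _ _ _) => i _.
apply: etrans (esym (tau_orbit SH (p i) U is_stab_cosets)).
apply: (@reindex_fsbig _ _ _ _ _ (fun (f : G -> cosets V) a => (i, f a) : D)).
split=> [f [[h Hh ->] Uf]|f f' _ _ E|f [[[[h Hh [f2 _]] Uf] [j fj]] fi]].
- split; [split; [split|]|] => //; last by exists i.
    by exists h => //; split=> // a; rewrite tmul1g.
  by move=> a u Uu; rewrite (Uf a u Uu).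
- by apply/funext => a; have := congr1 (fun q => (q a).2) E.
- exists (fun a => (f a).2); last first.
    apply/funext => a; rewrite [RHS]surjective_pairing fj.
    by rewrite -(fj 1%g) fi.
  split; first by exists h => //; apply/funext => a; rewrite f2.
  by move=> a u Uu; rewrite (Uf a u Uu).
Qed.

End PureSums.

(** * The image of the ghost map *)

Lemma subrBB2 (W : zmodType) (a b c s t : W) :
  a - (s + t) - (b - s) - (c - t) = a - b - c.
Proof.
rewrite opprD !opprB !addrA (addrAC (a - s) (- t) s) subrK.
by rewrite (addrAC a (- t) (- b)) subrK.
Qed.

Lemma subrBB3 (W : zmodType) (a b c x y : W) :
  x - a - (y - b) + (a - c - b) = x - y - c.
Proof.
rewrite opprB !addrA (addrAC x (- a) b) (addrAC (x + b) (- a) (- y)) subrK.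
by rewrite (addrAC x b (- y)) (addrAC (x - y) b (- c)) addrK.
Qed.

Lemma tprod_at_exist (G : topologicalGroupType) (B : set (openSubgroup G))
    (A : modObj) (x : tprod B A) V (BV : V \in B) :
  tprod_at x V = x (exist _ V BV).
Proof.
rewrite /tprod_at; case: pselect => [BV'|nBV]; last by case: nBV.
by congr (x (exist _ _ _)); apply: bool_irrelevance.
Qed.

Lemma tprod_at_val (G : topologicalGroupType) (B : set (openSubgroup G))
    (A : modObj) (n : forall V : openSubgroup G, tens A (cosets V)) V :
  B V -> tprod_at (fun V : set_type B => n (set_val V)) V = n V.
Proof. by move=> /mem_set BV; rewrite (tprod_at_exist _ BV). Qed.

Lemma tprod_at_out (G : topologicalGroupType) (B : set (openSubgroup G))
    (A : modObj) (x : tprod B A) V : ~ B V -> tprod_at x V = 0.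
Proof.
move=> nBV; rewrite /tprod_at; case: pselect => // BV.
by case: nBV; apply: set_mem.
Qed.

Section GhostRange.
Variable G : topologicalGroupType.
Hypothesis cG : compact [set: G].
Variables (H : openSubgroup G) (S : set (openSubgroup G)).
Hypothesis hS : truncation_set H S.
Variables (ch : ghostChoice H S) (A : modObj).
Implicit Types (U V W : openSubgroup G).

Let SH U : S U -> U `<=` H. Proof. by case: hS => + _ _; apply. Qed.
Let SJ h U : osub H h -> S U -> S (conjos h U).
Proof. by case: hS => _ + _; apply. Qed.
Let repsS V : reps ch V -> S V. Proof. exact: reps_sub. Qed.

Notation gs := (ghost_summand ch).
Notation locspan := (@locspan G H S A).

Lemma subconj_refl U : subconj H U U.
Proof. by exists 1%g; [apply: osub1 | rewrite tinvg1 conjos1]. Qed.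

Lemma subconj_conj h U V : osub H h -> subconj H U V -> subconj H U (conjos h V).
Proof.
move=> Hh [g Hg UV]; exists (g * h^-1)%g; first by apply: osubM => //; apply: osubV.
by rewrite tinvgM tinvgK -conjosM; apply: conjosS.
Qed.

(** The leading terms [tau] are additive in the list of pure tensors and cancel; only corrections of
    larger index remain. *)
Lemma ghost_summand_add V (n m : tens A (cosets V)) : S V ->
  locspan (below H V) (gs (n + m) - gs n - gs m).
Proof.
move=> SV; pose c0 : cosets V := \pi_(cosets V) 1%g.
have [k [p ->]] := tens_sum_pure c0 n; have [l [q ->]] := tens_sum_pure c0 m.
have [pq E] := big_ord_cat p q; rewrite -(E _ (@tpure _ A (cosets V))).
have Kp := ghost_summand_pures cG hS ch SV p.
have Kq := ghost_summand_pures cG hS ch SV q.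
have := ghost_summand_pures cG hS ch SV pq.
rewrite (E _ (fun p => tau H S V (p \o \pi_(cosets V)))) => Kpq.
have := locspanB cG (locspanB cG Kpq Kp) Kq; congr locspan; exact: subrBB2.
Qed.

(** The elements congruent to some ghost summand form a subgroup by [ghost_summand_add], and they
    include each [tau]. *)
Lemma zspan_ghost_summand V y : S V -> y \in zspan (taus H S A V) ->
  exists n : tens A (cosets V), locspan (below H V) (y - gs n).
Proof.
move=> SV /asboolP/(_ (fun y => `[< exists n : tens A (cosets V),
  locspan (below H V) (y - gs n) >])) E; apply/asboolP; apply: E.
  split=> [|x y' /asboolP[n xn] /asboolP[m ym]]; apply/asboolP.
    (* For n = m = 0 the additivity defect is 0 - gs 0. *)
    exists 0; have := ghost_summand_add 0 0 SV.
    by rewrite addr0 subrr.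
  exists (n - m); have := ghost_summand_add (n - m) m SV; rewrite subrK.
  move=> /(locspanD cG (locspanB cG xn ym)); congr locspan; exact: subrBB3.
move=> _ [q Vq ->]; apply/asboolP.
exists (tpure (fun c : cosets V => q (repr c))).
have := ghost_summand_pures cG hS ch SV (fun (_ : 'I_1) c => q (repr c)).
rewrite !big_ord1 => /(locspanB cG (locspan0 _ _ _ _)).
rewrite sub0r opprB; congr (locspan _ (tau H S V _ - _)).
by apply/funext => a; rewrite /= rinv_repr.
Qed.

Lemma ghost_summand_locspan V (n : tens A (cosets V)) : S V ->
  locspan [set W | subconj H W V] (gs n).
Proof.
move=> SV; have [k [p ->]] := tens_sum_pure (\pi_(cosets V) 1%g) n.
rewrite -[gs _](subrK (\sum_i tau H S V (p i \o \pi_(cosets V)))).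
apply: (locspanD cG).
  by apply: locspanS (ghost_summand_pures cG hS ch SV p) => W [].
apply: (@locspanS _ _ _ _ [set V]) => [_ ->|]; first exact: subconj_refl.
apply: (locspan_zspan SV); apply: rpred_sum => i _; apply: mem_zspan.
exists (p i \o \pi_(cosets V)) => // a u Vu; congr (p i _).
by apply/cosetsP; rewrite !tgroupE; apply: osubV.
Qed.

Lemma ghost_polyE (n : tprod (reps ch) A) (U : set_type S) :
  ghost_poly n U = \sum_(V \in reps ch) gs (tprod_at n V) U.
Proof. by []. Qed.

Lemma ghost_poly_locspan (n : tprod (reps ch) A) : locspan setT (ghost_poly n).
Proof.
apply: (locspan_sum cG (P := fun V => [set W | subconj H W V])
    (x := fun V => gs (tprod_at n V))) => [V /repsS SV|V W _ VW //].
exact: ghost_summand_locspan.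
Qed.

(** Translating by h^-1 does not change an H-orbit. The labels [beta] are split off because [q]
    itself may have a larger stabilizer than the coset-valued function. *)
Lemma taus_conj V h : S V -> osub H h -> taus H S A (conjos h V) `<=` taus H S A V.
Proof.
move=> SV Hh _ [q hVq ->].
have Vq : rinv V (fun a => q (a * h^-1)%g).
  by apply: rinv_conj; rewrite tinvgK.
exists (fun a => q (a * h^-1)%g) => //; apply: functional_extensionality_dep => U.
pose beta (c : cosets V) := q (repr c * h^-1)%g.
have sV := is_stab_cosets hS SV.
have sVh : is_stab H (fun a => \pi_(cosets V) (a * h)%g) (conjos h V).
  move=> x; split=> [hVx|[Hx /(_ h^-1%g)]]; last first.
    by rewrite !tgroupE => /cosetsP; rewrite conjosE !tgroupE => /osubVE; rewrite !tgroupE.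
  split; first by apply: (SH (SJ Hh SV)).
  move=> a; apply/cosetsP; rewrite !tgroupE.
  by move: hVx; rewrite conjosE => /osubV; rewrite !tgroupE.
have E1 : (fun a => q (a * h^-1)%g) = beta \o \pi_(cosets V).
  by apply/funext => a; rewrite /beta /= (rinv_repr a Vq).
have E2 : q = beta \o (fun a => \pi_(cosets V) (a * h)%g).
  by apply/funext => a; rewrite /beta /= (rinv_repr (a * h)%g Vq) !tgroupE.
rewrite E1 {1}E2.
apply: (etrans (tau_orbit SH beta U sVh)).
apply: (etrans _ (esym (tau_orbit SH beta U sV))).
apply: eq_fsbigl; congr (_ `&` _); apply/seteqP; split=> _ [g Hg ->].
  exists (g * h)%g; first exact: osubM.
  by apply/funext => a; rewrite tmulgA.
exists (g * h^-1)%g; first by apply: osubM => //; apply: osubV.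
by apply/funext => a; rewrite !tgroupE.
Qed.

Lemma zspanS (W : zmodType) (B C : set W) x : B `<=` C -> x \in zspan B -> x \in zspan C.
Proof.
move=> BC /asboolP E; apply: E; first exact: zspan_closed.
by move=> b /BC/mem_zspan.
Qed.

(** The coefficients at all conjugates of a representative are moved to it by [taus_conj].
    Conjugates are finitely many and have equal index, so the bound [j] survives. *)
Lemma locspan_reps j x : locspan [set V | (j <= idx V)%N] x ->
  exists y, [/\ forall V, reps ch V -> y V \in zspan (taus H S A V),
    forall V, (idx V < j)%N -> y V = 0 &
    forall U : set_type S, x U = \sum_(V \in reps ch) y V U].
Proof.
move=> [y [yT y0 yE]].
pose cls V := [set W | exists2 h, osub H h & W = conjos h V].
have fcls V : finite_set (cls V).
  apply: sub_finite_set (finite_subconj cG H V) => _ [h Hh ->].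
  by exists h^-1%g; [apply: osubV | rewrite tinvgK].
exists (fun V => \sum_(W \in cls V) y W); split=> [V /repsS SV|V Vj|U].
- rewrite fsbig_finite ?big_seq //; apply: rpred_sum => W.
  rewrite in_fset_set // => /set_mem[h Hh WE].
  by apply: zspanS (yT W); rewrite WE; apply: taus_conj.
- apply: fsbig1 => _ [h _ ->]; apply: y0.
  by rewrite /mkset (idx_conj cG) leqNgt Vj.
pose g W := xget W [set V | reps ch V /\ cls V W].
have gE V W : reps ch V -> cls V W -> g W = V.
  move=> rV [h Hh WE]; apply: xget_unique; first by split=> //; exists h.
  move=> V' [rV' [h' Hh' WE']]; apply: (reps_uniq (h := (h'^-1 * h)%g) rV rV').
    by apply: osubM => //; apply: osubV.
  by rewrite -conjosM -WE WE' conjosK.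
have zT V : reps ch V -> \sum_(W \in cls V) y W \in zspan (taus H S A V).
  move=> /repsS SV; rewrite fsbig_finite ?big_seq //; apply: rpred_sum => W.
  rewrite in_fset_set // => /set_mem[h Hh WE].
  by apply: zspanS (yT W); rewrite WE; apply: taus_conj.
rewrite yE (fsbig_above U S yT).
rewrite (@fsbig_partition _ _ _ _ (reps ch `&` [set V | subconj H (set_val U) V]) g).
- rewrite -(@fsbig_widen _ _ _ _ (reps ch `&` [set V | subconj H (set_val U) V])
    (reps ch)); last 2 first.
  + by move=> V [].
  + move=> V [rV nV]; apply: (zspan_taus_eq0 (zT V rV)) => UV.
    by apply: nV.
  refine (@eq_fsbigr _ _ _ _ _ _ _ _) => V /set_mem[rV UV].
  rewrite fsbig_tprodE //.
  refine (@eq_fsbigl _ _ _ _ _ _ _ _); apply/seteqP; split=> W.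
    move=> [[SW UW] gW]; have [V' [h [rV' Hh WE]]] := reps_ex ch SW.
    have cW : cls V' W by exists h.
    by rewrite -gW (gE _ _ rV' cW).
  move=> cW; split; last exact: gE.
  have [h Hh ->] := cW; split; last exact: subconj_conj.
  by apply: SJ => //; apply: repsS.
- exact: finite_subconj_in.
- exact: finite_subconj_in.
- move=> W [SW UW]; have [V [h [rV Hh WE]]] := reps_ex ch SW.
  have cW : cls V W by exists h.
  rewrite (gE _ _ rV cW); split=> //.
  by rewrite /mkset -[V](conjosK h) -WE; apply: subconj_conj => //; apply: osubV.
Qed.

Lemma ghost_summand_eq0 V (n : tens A (cosets V)) (U : set_type S) :
  ~ subconj H (set_val U) V -> gs n U = 0.
Proof.
move=> nUV; apply: fsbig1 => c Uc; case: nUV.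
by exists (set_val (repr c)) => //; apply: relcosets_mem.
Qed.

(** All representatives of one index, possibly infinitely many, are treated in a single step. *)
Definition level_sum j (n : forall V, tens A (cosets V)) : tprod S A :=
  fun U : set_type S => \sum_(V \in reps ch) if idx V == j then gs (n V) U else 0.

(** Each coefficient of index [j] is replaced by its error against a ghost summand, which has larger
    index; coefficients of larger index stay. *)
Lemma locspan_step j x : locspan [set V | (j <= idx V)%N] x ->
  exists n, locspan [set V | (j < idx V)%N] (x - level_sum j n).
Proof.
move=> /locspan_reps[y [yT y0 yE]].
have n_ex V : exists n : tens A (cosets V),
    reps ch V -> locspan (below H V) (y V - gs n).
  have [rV|nrV] := pselect (reps ch V); last by exists 0.
  by have [n ?] := zspan_ghost_summand (repsS rV) (yT _ rV); exists n.
pose n V := sval (cid (n_ex V)).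
have nP V : reps ch V -> locspan (below H V) (y V - gs (n V)).
  by rewrite /n; case: cid.
exists n; pose z V : tprod S A := if idx V == j then y V - gs (n V) else y V.
have -> : x - level_sum j n = (fun U : set_type S => \sum_(V \in reps ch) z V U).
  apply: functional_extensionality_dep => U.
  pose T := reps ch `&` [set V | subconj H (set_val U) V].
  have fT : finite_set T by apply: finite_subconj_in.
  have T0 (F : openSubgroup G -> tens A (cosets (set_val U))) :
      (forall V, reps ch V -> ~ subconj H (set_val U) V -> F V = 0) ->
      \sum_(V \in reps ch) F V = \sum_(V \in T) F V.
    move=> F0; apply/esym/fsbig_widen => V; first by case.
    by move=> [rV nT]; apply: F0 => // UV; apply: nT.
  rewrite -[LHS]/(x U - level_sum j n U) yE /level_sum.
  have y00 V : reps ch V -> ~ subconj H (set_val U) V -> y V U = 0.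
    by move=> rV; apply: zspan_taus_eq0 (yT V rV).
  rewrite !T0 //; first last.
  - by move=> V rV nUV; rewrite (ghost_summand_eq0 (n V) nUV) if_same.
  - move=> V rV nUV; rewrite /z; case: ifP => _; last exact: y00.
    by rewrite -[LHS]/(y V U - gs (n V) U) y00 // (ghost_summand_eq0 (n V) nUV) subr0.
  apply: (etrans (fsbigBE _ _ fT)).
  refine (@eq_fsbigr _ _ _ _ _ _ _ _) => V _.
  by rewrite /z; case: ifP => _ //; rewrite subr0.
apply: (locspan_sum cG (P := fun V => [set W | subconj H W V /\ (j < idx W)%N]))
  => [V rV|V W _ [] //].
rewrite /z; case: eqP => [<-|/eqP nj]; first exact: nP.
have [jV|Vj] := leqP (idx V) j.
  rewrite y0; first exact: locspan0.
  by rewrite ltn_neqAle nj.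
apply: (@locspanS _ _ _ _ [set V]) => [_ ->|].
  by split=> //; apply: subconj_refl.
by apply: (locspan_zspan (repsS rV)); apply: yT.
Qed.

(* As the index of the subgroups that contribute to the U-component is bounded
   by that of U, the corrections of successive levels add up componentwise. *)
Lemma locspan_ghost_poly x : locspan setT x -> exists n : tprod (reps ch) A, ghost_poly n = x.
Proof.
(* A correction is chosen for every level and remainder, with default 0, so that the recursion
   defining [X] carries no proofs. *)
move=> xL; have step_ex jx : exists n, locspan [set V | (jx.1 <= idx V)%N] jx.2 ->
    locspan [set V | (jx.1 < idx V)%N] (jx.2 - level_sum jx.1 n).
  have [L|nL] := pselect (locspan [set V | (jx.1 <= idx V)%N] jx.2).
    by have [n ?] := locspan_step L; exists n.
  by exists (fun=> 0).
have [N NP] := choice step_ex.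
pose X := fix X j := if j is i.+1 then X i - level_sum i (N (i, X i)) else x.
have XP j : locspan [set V | (j <= idx V)%N] (X j).
  elim: j => [|j IH]; first by apply: locspanS xL.
  exact: (NP (j, X j)).
(* The coordinate at V is the one used at level [idx V], the only level that subtracts a ghost
   summand at V. *)
pose n V := N (idx V, X (idx V)) V.
exists (fun V : set_type (reps ch) => n (set_val V)).
apply: functional_extensionality_dep => U.
pose T := reps ch `&` [set V | subconj H (set_val U) V].
have fT : finite_set T by apply: finite_subconj_in.
have T0 (F : openSubgroup G -> tens A (cosets (set_val U))) :
    (forall V, reps ch V -> ~ subconj H (set_val U) V -> F V = 0) ->
    \sum_(V \in reps ch) F V = \sum_(V \in T) F V.
  move=> F0; apply/esym/fsbig_widen => V; first by case.
  by move=> [rV nT]; apply: F0 => // UV; apply: nT.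
rewrite ghost_polyE T0 => [|V _]; last exact: ghost_summand_eq0.
(* The first level beyond every V that contributes to [U], so the remainder has U-component 0. *)
pose J := (idx (set_val U)).+1.
have XJ : X J U = 0.
  have [y [yT y0 ->]] := XP J; apply: fsbig1 => V SV.
  have [UV|] := pselect (subconj H (set_val U) V).
    by rewrite y0 // => /= /leq_trans/(_ (subconj_idx cG UV)); rewrite ltnn.
  exact: zspan_taus_eq0.
have XE j : x U = X j U + \sum_(V \in T) if (idx V < j)%N then gs (n V) U else 0.
  elim: j => [|j IH]; first by rewrite fsbig1 // addr0.
  rewrite IH -[X j.+1 U]/(X j U - level_sum j (N (j, X j)) U) -addrA.
  apply: (congr1 (+%R (X j U))).
  have -> : level_sum j (N (j, X j)) U =
      \sum_(V \in T) if idx V == j then gs (N (j, X j) V) U else 0.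
    apply: T0 => V _ nUV.
    by rewrite (ghost_summand_eq0 _ nUV) if_same.
  apply/esym; rewrite addrC; apply/eqP; rewrite subr_eq; apply/eqP.
  apply: (etrans _ (esym (fsbigDE _ _ fT))).
  refine (@eq_fsbigr _ _ _ _ _ _ _ _) => V _.
  rewrite ltnS leq_eqVlt; case: eqP => [<-|_] /=; last by rewrite addr0.
  by rewrite ltnn add0r.
rewrite (XE J) XJ add0r; refine (@eq_fsbigr _ _ _ _ _ _ _ _) => V /set_mem[rV UV].
by rewrite ltnS (subconj_idx cG UV) (tprod_at_val n rV).
Qed.

Lemma free_wittE : @free_witt _ _ _ ch A = [set x | locspan setT x].
Proof.
apply/seteqP; split=> [_ [n _ <-]|x /locspan_ghost_poly[n <-]].
  exact: ghost_poly_locspan.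
by exists n.
Qed.

End GhostRange.

(** * The transfer on the image of the ghost map *)

Section ProductMaps.
Variable G : topologicalGroupType.
Implicit Types (A B : modObj) (U V W : openSubgroup G) (S : set (openSubgroup G)).

Lemma tprod_nbhs_coord S A (z : tprod S A) (U : set_type S) :
  nbhs z [set z' : tprod S A | z' U = z U].
Proof.
pose K (W : set_type S) := discrete_topology (tens A (cosets (set_val W))).
apply: (@proj_continuous _ K U z [set t | t = z U]).
exact: discrete_set1.
Qed.

Lemma tprod_nbhs_coords S A (z : tprod S A) (s : seq (set_type S)) :
  nbhs z [set z' : tprod S A | forall U : set_type S, U \in s -> z' U = z U].
Proof.
elim: s => [|U s IH]; first exact: filterE.
apply: filterS (filterI (tprod_nbhs_coord z U) IH) => z' [zU zs] W.
by rewrite inE => /orP[/eqP->|/zs].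
Qed.

(** The factors are discrete, so it suffices that each component depends on finitely many
    coordinates. *)
Lemma tprod_continuous S S' A B (f : tprod S A -> tprod S' B) :
  (forall U : set_type S', exists s : seq (set_type S), forall x x',
    (forall W : set_type S, W \in s -> x W = x' W) -> f x U = f x' U) ->
  continuous f.
Proof.
move=> fP z; have FF : Filter (f x @[x --> z]) by apply: fmap_filter; exact: nbhs_filter.
apply/cvg_sup => U N [C [[W _ <-] /= Wz] WN].
have [s sP] := fP U; suff : nbhs z (f @^-1` N) by [].
apply: filterS (tprod_nbhs_coords z s) => z' zz'; apply: WN => /=.
by rewrite (sP _ _ zz').
Qed.

Lemma multilinear_tens_map A B (phi : modHom A B) (X : choiceType) :
  multilinear (hbase phi) (fun m : X -> A => tpure (phi \o m) : tens B X).
Proof.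
by move=> m i a x y; rewrite !dfwith_comp linearD linearZ tpure_lin.
Qed.

Lemma tens_mapD A B (phi : modHom A B) (X : choiceType) :
  {morph @tens_map A X B phi : t u / t + u}.
Proof. exact: (@tliftD _ _ _ _ _ (hbase phi) _ (@multilinear_tens_map _ _ phi X)). Qed.

Lemma tens_mapZ A B (phi : modHom A B) (X : choiceType) a (t : tens A X) :
  tens_map phi (a *: t) = hbase phi a *: tens_map phi t.
Proof. exact: (@tliftZ _ _ _ _ _ (hbase phi) _ (@multilinear_tens_map _ _ phi X)). Qed.

Lemma tens_map0 A B (phi : modHom A B) (X : choiceType) : @tens_map A X B phi 0 = 0.
Proof.
have := tens_mapZ phi (0 : mbase A) (0 : tens A X).
by rewrite scale0r rmorph0 scale0r.
Qed.

Lemma tens_map_tfun A B (phi : modHom A B) U (q : G -> A) :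
  tens_map phi (tfun U q) = tfun U (phi \o q).
Proof. exact: tens_map_pure. Qed.

Lemma tprod_mapD S A B (phi : modHom A B) :
  {morph @tprod_map G S A B phi : x y / x + y}.
Proof.
by move=> x y; apply: functional_extensionality_dep => U; apply: tens_mapD.
Qed.

Lemma tprod_map0 S A B (phi : modHom A B) : @tprod_map G S A B phi 0 = 0.
Proof. by apply: functional_extensionality_dep => U; apply: tens_map0. Qed.

Lemma morphB (V W : zmodType) (f : V -> W) :
  {morph f : x y / x + y} -> {morph f : x y / x - y}.
Proof.
move=> fD x y; apply: (addIr (f y)).
by rewrite -fD !subrK.
Qed.

Lemma tprod_mapB S A B (phi : modHom A B) :
  {morph @tprod_map G S A B phi : x y / x - y}.
Proof. exact: morphB (@tprod_mapD S A B phi). Qed.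

Lemma tprod_map_continuous S A B (phi : modHom A B) :
  continuous (@tprod_map G S A B phi).
Proof.
apply: tprod_continuous => U; exists [:: U] => x x' xx'.
by rewrite /tprod_map xx' // mem_head.
Qed.

Lemma zspan_morph (V W : zmodType) (f : V -> W) (C : set V) (D : set W) x :
  {morph f : x y / x + y} -> (forall c, C c -> f c \in zspan D) ->
  x \in zspan C -> f x \in zspan D.
Proof.
move=> fD CD /asboolP/(_ (fun x => f x \in zspan D)); apply=> //.
have fB := morphB fD; split=> [|y z Dy Dz].
  by rewrite unfold_in -(subrr 0) fB subrr; apply: rpred0.
by rewrite unfold_in fB; apply: rpredB.
Qed.

Hypothesis cG : compact [set: G].

Section Locspan.
Variables (H : openSubgroup G) (S : set (openSubgroup G)).
Variables (A B : modObj) (phi : modHom A B).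

Lemma tprod_map_tau V q : tprod_map phi (tau H S V q) = tau H S V (phi \o q).
Proof.
apply: functional_extensionality_dep => U; rewrite /tprod_map /tau.
rewrite (fsbig_morph _ (tens_map0 phi _) (@tens_mapD _ _ phi _)); last first.
  by apply: sub_finite_set (finite_relcosets cG H V).
by refine (@eq_fsbigr _ _ _ _ _ _ _ _) => c _; apply: tens_map_tfun.
Qed.

Lemma tprod_map_zspan V x : x \in zspan (taus H S A V) ->
  tprod_map phi x \in zspan (taus H S B V).
Proof.
apply: zspan_morph; first exact: tprod_mapD.
move=> _ [q Vq ->]; apply: mem_zspan; exists (phi \o q).
  by move=> a u Vu; rewrite /= Vq.
exact: tprod_map_tau.
Qed.

(** Through L this yields the functoriality of im(w) without comparing tensor powers along [phi]. *)
Lemma tprod_map_locspan P (x : tprod S A) :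
  locspan H P x -> locspan H P (tprod_map phi x).
Proof.
move=> [y [yT y0 yE]]; exists (fun V => tprod_map phi (y V)).
have yT' V := tprod_map_zspan (yT V); split=> // [V nP|U].
  by rewrite y0 // tprod_map0.
rewrite (fsbig_above U S yT') /tprod_map yE (fsbig_above U S yT).
apply: (@fsbig_morph _ _ _ (tens_map phi)); first exact: tens_map0.
  exact: tens_mapD.
exact: finite_subconj_in.
Qed.

End Locspan.
End ProductMaps.

Section Verschiebung.
Variable G : topologicalGroupType.
Hypothesis cG : compact [set: G].
Variables (H K : openSubgroup G) (S : set (openSubgroup G)).
Hypothesis KH : K `<=` H.
Hypothesis hS : truncation_set H S.
Implicit Types (A B : modObj) (U V W : openSubgroup G).

Notation SK := (restr_trunc S K).
Notation ver := (@ghost_verschiebung G H K S _).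

Lemma restr_truncP : truncation_set K SK.
Proof.
case: hS => S1 S2 S3; split=> [U []//|h U Kh [SU UK]|U V [SU UK] UV VK].
  split; first by apply: S2 => //; apply: KH.
  by rewrite -(conjos_id Kh); apply: conjosS.
by split=> //; apply: (S3 _ _ SU UV) => x /VK/KH.
Qed.

Lemma verE A (x : tprod SK A) (U : set_type S) :
  ver x U = \sum_(c \in [set: relcosets H K])
    (tens_act (set_val (repr c))
      (tprod_at x (conjos (set_val (repr c))^-1%g (set_val U))) :
      tens A (cosets (set_val U))).
Proof.
rewrite /ghost_verschiebung /transfer fsbig_tprodE; last exact: finite_relcosets.
refine (@eq_fsbigr _ _ _ _ _ _ _ _) => c _; rewrite /tprod_act; congr (tens_act _ _).
have [SW|nSW] := pselect (S (conjos (set_val (repr c))^-1%g (set_val U))).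
  by rewrite (tprod_at_exist _ (mem_set SW)).
by rewrite !tprod_at_out // => -[].
Qed.

Lemma tprod_atD A S' U : {morph (@tprod_at G S' A)^~ U : x y / x + y}.
Proof.
by move=> x y; rewrite /tprod_at; case: pselect => [//|_]; rewrite addr0.
Qed.

Lemma tprod_at_map A B (phi : modHom A B) S' (x : tprod S' A) U :
  tprod_at (tprod_map phi x) U = tens_map phi (tprod_at x U).
Proof. by rewrite /tprod_at; case: pselect => //; rewrite tens_map0. Qed.

Lemma verD A (x y : tprod SK A) : ver (x + y) = ver x + ver y.
Proof.
apply: functional_extensionality_dep => U.
rewrite -[RHS]/(ver x U + ver y U) !verE.
apply: (etrans _ (esym (fsbigDE _ _ (finite_relcosets cG H K)))).
refine (@eq_fsbigr _ _ _ _ _ _ _ _) => c _.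
by rewrite tprod_atD; apply: tens_actD.
Qed.

Lemma tens_map_act A B (phi : modHom A B) g U (t : tens A (cosets (conjos g^-1%g U))) :
  tens_map phi (tens_act g t : tens A (cosets U)) = tens_act g (tens_map phi t).
Proof.
elim/tens_ind: t => [|t u tE uE|c m].
- by rewrite tens_act0 !tens_map0 tens_act0.
- rewrite (@tens_actD G A g U t u) (@tens_mapD A B phi _ t u).
  rewrite (@tens_actD G B g U (tens_map phi t) (tens_map phi u)) -tE -uE.
  exact: tens_mapD.
rewrite /tens_act tens_mapZ !tens_reindexZ ?tens_mapZ; try exact: tens_act_bij.
by rewrite tens_map_pure !tens_reindex_pure ?tens_map_pure //; exact: tens_act_bij.
Qed.

Lemma ver_map A B (phi : modHom A B) (x : tprod SK A) :
  ver (tprod_map phi x) = tprod_map phi (ver x).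
Proof.
apply: functional_extensionality_dep => U; rewrite /tprod_map !verE.
rewrite (fsbig_morph _ (tens_map0 phi _) (@tens_mapD _ _ phi _)); last exact: finite_relcosets.
refine (@eq_fsbigr _ _ _ _ _ _ _ _) => c _.
by rewrite tens_map_act -tprod_at_map.
Qed.

Lemma ver_continuous A : continuous (ver : tprod SK A -> tprod S A).
Proof.
apply: tprod_continuous => U.
pose W (c : relcosets H K) := conjos (set_val (repr c))^-1%g (set_val U).
(* Only the conjugates of [U] in [SK] are coordinates of [x]; at the others the extension by zero is
   constant. *)
pose s := pmap (fun c => insub (W c) : option (set_type SK))
  (fset_set [set: relcosets H K]).
exists s => x x' xx'; rewrite !verE; refine (@eq_fsbigr _ _ _ _ _ _ _ _) => c _.
congr (tens_act _ _); rewrite -/(W c).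
have [SKW|nSKW] := pselect (SK (W c)); last by rewrite !tprod_at_out.
rewrite !(tprod_at_exist _ (mem_set SKW)).
suff cs : (exist _ (W c) (mem_set SKW) : set_type SK) \in s by have := xx' _ cs.
rewrite mem_pmap; apply/mapP; exists c.
  by rewrite in_fset_set ?inE //; apply: finite_relcosets.
by rewrite (insubT (fun x => x \in SK) (mem_set SKW)).
Qed.

Lemma finite_translates V : S V -> finite_set (translates H \pi_(cosets V)).
Proof.
move=> SV; apply: (@sub_finite_set _ _ ((fun (c : relcosets H V) a =>
    \pi_(cosets V) (a * set_val (repr c))%g) @` setT)).
  move=> _ [h Hh ->]; have [c Vc] := relcosets_ex V Hh; exists c => //.
  by apply/funext => a; apply/cosetsP; rewrite !tgroupE.
by apply: finite_image; apply: finite_relcosets.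
Qed.

Lemma tprod_at_tau A V W (beta : cosets V -> A) : SK V -> SK W ->
  tprod_at (tau K SK V (beta \o \pi_(cosets V))) W =
  \sum_(f \in translates K \pi_(cosets V) `&` rinv W) tfun W (beta \o f).
Proof.
move=> SKV SKW; rewrite (tprod_at_exist _ (mem_set SKW)).
have SKK U : SK U -> U `<=` K by case.
exact: (tau_orbit SKK beta (exist _ W (mem_set SKW))
  (is_stab_cosets restr_truncP SKV)).
Qed.

(** H/V is H x_K (K/V): the H-orbit of G -> G/V is the disjoint union, over H/K, of the translates
    of its K-orbit. *)
Lemma ver_tau A V (q : G -> A) : SK V -> rinv V q ->
  ver (tau K SK V q) = tau H S V q.
Proof.
move=> SKV Vq; have [SV VK] := SKV.
apply: functional_extensionality_dep => U; rewrite verE.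
pose beta (c : cosets V) := q (repr c).
have -> : q = beta \o \pi_(cosets V).
  by apply/funext => a; rewrite /beta /= rinv_repr.
have SH W : S W -> W `<=` H by case: hS => + _ _; apply.
apply: (etrans _ (esym (tau_orbit SH beta U (is_stab_cosets hS SV)))).
set F := _ `&` _; have fF : finite_set F.
  by apply: finite_setIl; apply: finite_translates.
(* The position of f over H/K: f is the translate by an element of the coset c, unique as [V] lies
   in [K]. *)
pose lies (c : relcosets H K) (f : G -> cosets V) := exists2 k, osub K k &
  f = fun a => \pi_(cosets V) (a * (set_val (repr c) * k))%g.
have [c0 _] := relcosets_ex K (osub1 H).
pose g f := xget c0 [set c | lies c f].
have gE c f : lies c f -> g f = c.
  move=> [k Kk fE]; apply: xget_unique; first by exists k.
  move=> d [l Kl fE']; apply: relcosets_inj.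
  have := congr1 (fun f => f 1%g) fE; rewrite {1}fE' !tmul1g => /cosetsP/VK.
  rewrite !tgroupE => /(osubMl _ (osubV Kl)); rewrite -tmulgA.
  by move/(osubMr _ Kk).
have liesP f : translates H \pi_(cosets V) f -> lies (g f) f.
  move=> [h Hh fE]; have [c Kc] := relcosets_ex K Hh.
  have cf : lies c f.
    by exists ((set_val (repr c))^-1 * h)%g => //; rewrite fE tmulVKg.
  by rewrite (gE _ _ cf).
rewrite [RHS](@fsbig_partition _ _ _ _ [set: relcosets H K] g) //; last first.
  exact: finite_relcosets.
refine (@eq_fsbigr _ _ _ _ _ _ _ _) => c _.
have gfib f : F f -> g f = c -> exists f', [/\ translates K \pi_(cosets V) f',
    rinv (conjos (set_val (repr c))^-1%g (set_val U)) f' &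
    f = fun a => f' (a * set_val (repr c))%g].
  move=> [Hf Uf] gf; have [k Kk fE] := liesP _ Hf; rewrite gf in fE.
  exists (fun a => f (a * (set_val (repr c))^-1)%g); split.
  - by exists k => //; apply/funext => a; rewrite fE !tgroupE.
  - by apply: rinv_conj; rewrite tinvgK conjosKV.
  - by apply/funext => a; rewrite !tgroupE.
have Hc := relcosets_mem c; move: gfib (gE c) => {gE}.
rewrite /lies; move: (set_val (repr c)) Hc => h Hh gfib gE.
set W := conjos h^-1%g _.
have SW : S W by case: hS => _ + _; apply; [apply: osubV | apply: set_valP].
(* If h^-1Uh is not in [K], the left side is an extension by zero. The right side is empty: a
   U-invariant f over this coset would put h^-1Uh into some kVk^-1 with k in [K]. *)
have [WK|nWK] := pselect (W `<=` K); last first.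
  rewrite tprod_at_out; last by move=> [].
  rewrite tens_act0 fsbig1 // => f [/gfib H1 /H1[f' [[k Kk f'E] Wf' _]]].
  case: nWK => w Ww; have := Wf' 1%g w Ww.
  rewrite f'E !tmul1g => /cosetsP/VK; rewrite !tgroupE => /(osubMl _ (osubV Kk)).
  by move/(osubMr _ Kk)/osubVE.
have SKW : SK W by [].
rewrite tprod_at_tau // (fsbig_morph _ (tens_act0 A h _) (@tens_actD _ A h _)); last first.
  apply: finite_setIl; apply: (@sub_finite_set _ _ (translates H \pi_(cosets V))).
    by move=> _ [k /KH Hk ->]; exists k.
  exact: finite_translates.
transitivity (\sum_(f \in translates K \pi_(cosets V) `&` rinv W)
    tfun (set_val U) (beta \o (fun a => f (a * h)%g))).
  refine (@eq_fsbigr _ _ _ _ _ _ _ _) => f /set_mem[_ Wf].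
  by apply: tens_act_tfun => a u Wu; rewrite /= Wf.
apply/esym.
apply: (@reindex_fsbig _ _ _ _ _ (fun (f : G -> cosets V) a => f (a * h)%g)).
split=> [f [[k Kk fE] Wf]|f f' _ _ E|f [Ff gf]].
- split; last by apply: gE; exists k => //; apply/funext => a; rewrite fE tmulgA.
  split; last exact: rinv_conj.
  exists (h * k)%g; first by apply: osubM => //; apply: KH.
  by apply/funext => a; rewrite fE tmulgA.
- apply/funext => a; have := congr1 (fun f => f (a * h^-1)%g) E.
  by rewrite /= !tgroupE.
- by have [f' [Kf' Wf' ->]] := gfib f Ff gf; exists f'.
Qed.

Lemma ver_zspan A V (x : tprod SK A) : SK V ->
  x \in zspan (taus K SK A V) -> ver x \in zspan (taus H S A V).
Proof.
move=> SKV; apply: zspan_morph; first exact: verD.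
by move=> _ [q Vq ->]; apply: mem_zspan; exists q => //; apply: ver_tau.
Qed.

(** Additivity handles finite sums only. For fixed [U] one finite set [T] of subgroups serves all
    conjugates h^-1Uh that enter the transfer, and the sums over [T] and H/K are exchanged. *)
Lemma ver_locspan A (x : tprod SK A) : locspan K setT x -> locspan H setT (ver x).
Proof.
move=> [y [yT _ yE]].
pose z V : tprod S A := if `[< SK V >] then ver (y V) else 0.
have zT V : z V \in zspan (taus H S A V).
  by rewrite /z; case: asboolP => [SKV|_]; [apply: ver_zspan | apply: rpred0].
exists z; split=> [//|V []//|U].
pose T := SK `&` [set V | subconj H (set_val U) V].
have fT : finite_set T by apply: finite_subconj_in.
have -> : \sum_(V \in S) z V U = \sum_(V \in T) ver (y V) U.
  transitivity (\sum_(V \in T) z V U); last first.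
    by refine (@eq_fsbigr _ _ _ _ _ _ _ _) => V /set_mem[SKV _]; rewrite /z asboolT.
  apply/esym/fsbig_widen => [V [[]]//|V [SV nTV]].
  have [UV|] := pselect (subconj H (set_val U) V); last exact: zspan_taus_eq0.
  by rewrite /= /z asboolF // => SKV; apply: nTV.
rewrite verE; transitivity (\sum_(V \in T) \sum_(c \in [set: relcosets H K])
    (tens_act (set_val (repr c))
      (tprod_at (y V) (conjos (set_val (repr c))^-1%g (set_val U))) :
      tens A (cosets (set_val U)))); last first.
  by refine (@eq_fsbigr _ _ _ _ _ _ _ _) => V _; rewrite verE.
transitivity (\sum_(c \in [set: relcosets H K]) \sum_(V \in T)
    (tens_act (set_val (repr c))
      (tprod_at (y V) (conjos (set_val (repr c))^-1%g (set_val U))) :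
      tens A (cosets (set_val U)))); last first.
  by apply: exchange_fsbig => //; apply: finite_relcosets.
refine (@eq_fsbigr _ _ _ _ _ _ _ _) => c _; have Hc := relcosets_mem c.
move: (set_val (repr c)) Hc => h Hh; set W := conjos _ _.
have -> : tprod_at x W = \sum_(V \in T) tprod_at (y V) W.
  have [SKW|nSKW] := pselect (SK W); last first.
    by rewrite tprod_at_out // fsbig1 // => V _; rewrite tprod_at_out.
  rewrite (tprod_at_exist _ (mem_set SKW)) yE.
  transitivity (\sum_(V \in T) y V (exist _ W (mem_set SKW))); last first.
    by refine (@eq_fsbigr _ _ _ _ _ _ _ _) => V _; rewrite (tprod_at_exist _ (mem_set SKW)).
  apply/esym/fsbig_widen => [V []//|V [SKV nTV]].
  apply: (@zspan_taus_eq0 _ _ _ _ _ _ (exist _ W (mem_set SKW)) (yT V)).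
  move=> -[k /KH Hk WV]; apply: nTV; split=> //.
  exists (h * k)%g; first exact: osubM.
  by rewrite tinvgM -conjosM.
by apply: (@fsbig_morph _ _ _ (@tens_act G A h W (set_val U)));
  [apply: tens_act0 | apply: tens_actD | ].
Qed.

End Verschiebung.

(** * The free-forgetful adjunction *)

Section FreeExtensionality.
Variables X Y : choiceType.

(** Induction on the degree of a monomial, splitting off one variable. *)
Lemma free_base_ext (R : comPzRingType) (f g : {rmorphism mbase (freeObj X Y) -> R}) :
  (forall x, f << 1 *g ucm x >> = g << 1 *g ucm x >>) -> f =1 g.
Proof.
move=> fg; have E m : f << 1 *g m >> = g << 1 *g m >>.
  have [n] := ubnP (mdeg m); elim: n m => // n IH m mn.
  have [/eqP m0|m0] := boolP (mdeg m == 0)%N.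
    have -> : << 1 *g m >> = 1 :> mbase (freeObj X Y) by rewrite (mdeg_eq0I m0).
    by rewrite !rmorph1.
  have [x mx] : exists x, m x != 0%N.
    have [m0'|[x xm]] := fset_0Vmem (finsupp m); last first.
      by exists x; rewrite -mem_finsupp.
    by move: m0; rewrite mdegE m0' big_seq_fset0 eqxx.
  have mE : m = mmul (ucm x) (divcm m (ucm x)).
    apply/eqP/cmP => y; rewrite mulcmE divcmE ucmE.
    by case: eqP => [<-|_]; rewrite ?subn0 // subnKC // lt0n.
  have UE (a b : {cmonom X}) : << 1 *g mmul a b >> =
      << 1 *g a >> * << 1 *g b >> :> mbase (freeObj X Y).
    by rewrite malgM_def fgmulUU mulr1.
  have m'n : (mdeg (divcm m (ucm x)) < n)%N.
    by move: mn; rewrite {1}mE mdegM mdegU add1n ltnS.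
  have -> : << 1 *g m >> = << 1 *g ucm x >> * << 1 *g divcm m (ucm x) >> :>
      mbase (freeObj X Y) by rewrite -UE -mE.
  apply: (etrans (rmorphM f _ _)); apply: (etrans _ (esym (rmorphM g _ _))).
  exact: (congr2 *%R (fg x) (IH _ m'n)).
move=> p; rewrite [p]monalgE !raddf_sum; apply: eq_bigr => m _ /=.
have -> : << p@_m *g m >> = << 1 *g m >> *~ p@_m :> mbase (freeObj X Y).
  by apply: (etrans _ (raddfMz (mkmalgU m) _ _)); rewrite intz.
by rewrite !raddfMz /= E.
Qed.

(** Semilinearity is an explicit hypothesis because the lemma is applied to composites of maps
    linear over different ring homomorphisms. *)
Lemma free_car_ext (R : comPzRingType) (N : lmodType R)
    (fb gb : {rmorphism mbase (freeObj X Y) -> R}) (f g : freeObj X Y -> N) :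
  {morph f : p q / p + q} -> {morph g : p q / p + q} ->
  (forall c q, f (c *: q) = fb c *: f q) -> (forall c q, g (c *: q) = gb c *: g q) ->
  (forall x, fb << 1 *g ucm x >> = gb << 1 *g ucm x >>) ->
  (forall y, f << 1 *g y >> = g << 1 *g y >>) -> f =1 g.
Proof.
move=> fD gD fZ gZ /free_base_ext fgb fg q.
have f0 : f 0 = 0 by have := fZ 0 0; rewrite scale0r rmorph0 scale0r.
have g0 : g 0 = 0 by have := gZ 0 0; rewrite scale0r rmorph0 scale0r.
rewrite [q]monalgE (big_morph f fD f0) (big_morph g gD g0).
apply: eq_bigr => y _.
have -> : << q@_y *g y >> = q@_y *: << 1 *g y >> :> freeObj X Y.
  by apply/malgP => k; rewrite mcoeffZ !mcoeffU mulrnAr mulr1.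
by rewrite fZ gZ fgb fg.
Qed.

Variables (A : modObj) (h : X -> mbase A) (k : Y -> A).

Lemma free_adj_base x : hbase (free_adj h k) << 1 *g ucm x >> = h x.
Proof.
apply: (etrans (poly_evalU Y h 1 (ucm x))); rewrite mul1r.
by rewrite /monom_eval mdomU big_seq_fset1 cmUU expr1.
Qed.

Lemma free_adj_car y : free_adj h k << 1 *g y >> = k y.
Proof.
apply: (etrans (lin_evalEw h k msuppU_le)).
by rewrite big_seq_fset1 mcoeffUU rmorph1 scale1r.
Qed.

End FreeExtensionality.

Section FreeMaps.
Implicit Types A B C : modObj.

(** Stated pointwise, which avoids equalities between bundled morphisms. *)
Definition comm_square A B B' C (phi : modHom B C) (psi : modHom A B)
    (phi' : modHom B' C) (psi' : modHom A B') :=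
  (forall a, hbase phi (hbase psi a) = hbase phi' (hbase psi' a)) /\
  (forall m, phi (psi m) = phi' (psi' m)).

Definition retraction A B (phi : modHom B A) (psi : modHom A B) :=
  (forall a, hbase phi (hbase psi a) = a) /\ (forall m, phi (psi m) = m).

Lemma modHom_compD A B C (phi : modHom B C) (psi : modHom A B) :
  {morph phi \o psi : p q / p + q}.
Proof. by move=> p q; rewrite /= !raddfD. Qed.

Lemma modHom_compZ A B C (phi : modHom B C) (psi : modHom A B) c m :
  (phi \o psi) (c *: m) = (hbase phi \o hbase psi) c *: (phi \o psi) m.
Proof. by rewrite /= !linearZ. Qed.

Lemma comm_square_free X Y B B' C (phi : modHom B C) (psi : modHom (freeObj X Y) B)
    (phi' : modHom B' C) (psi' : modHom (freeObj X Y) B') :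
  (forall x, hbase phi (hbase psi << 1 *g ucm x >>) =
             hbase phi' (hbase psi' << 1 *g ucm x >>)) ->
  (forall y, phi (psi << 1 *g y >>) = phi' (psi' << 1 *g y >>)) ->
  comm_square phi psi phi' psi'.
Proof.
move=> Eb Ec; split.
  exact: (@free_base_ext X Y _ (hbase phi \o hbase psi) (hbase phi' \o hbase psi')).
apply: (@free_car_ext X Y _ _ (hbase phi \o hbase psi) (hbase phi' \o hbase psi')
  (phi \o psi) (phi' \o psi')) => //; try exact: modHom_compD; exact: modHom_compZ.
Qed.

Lemma retraction_free X Y B (phi : modHom B (freeObj X Y)) (psi : modHom (freeObj X Y) B) :
  (forall x, hbase phi (hbase psi << 1 *g ucm x >>) = << 1 *g ucm x >>) ->
  (forall y, phi (psi << 1 *g y >>) = << 1 *g y >>) ->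
  retraction phi psi.
Proof.
move=> Eb Ec; split.
  exact: (@free_base_ext X Y _ (hbase phi \o hbase psi) idfun).
exact: (@free_car_ext X Y (mbase (freeObj X Y)) (mcar (freeObj X Y))
  (hbase phi \o hbase psi) idfun (phi \o psi) idfun
  (modHom_compD phi psi) (fun _ _ => erefl) (modHom_compZ phi psi)
  (fun _ _ => erefl) Eb Ec).
Qed.

Lemma counit_nat A B (phi : modHom A B) :
  comm_square (counit B) (FU_map phi) phi (counit A).
Proof.
by apply: comm_square_free => x; rewrite ?free_adj_base ?free_adj_car.
Qed.

Lemma FU_map_comm A B B' C (phi : modHom B C) (psi : modHom A B)
    (phi' : modHom B' C) (psi' : modHom A B') :
  comm_square phi psi phi' psi' ->
  comm_square (FU_map phi) (FU_map psi) (FU_map phi') (FU_map psi').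
Proof.
move=> [Eb Ec]; apply: comm_square_free => x.
  by rewrite !free_adj_base Eb.
by rewrite !free_adj_car Ec.
Qed.

Lemma FU_map_retraction A B (phi : modHom B A) (psi : modHom A B) :
  retraction phi psi -> retraction (FU_map phi) (FU_map psi).
Proof.
move=> [Eb Ec]; apply: retraction_free => x.
  by rewrite !free_adj_base Eb.
by rewrite !free_adj_car Ec.
Qed.

(* F applied to the unit of the adjunction: a common section of the two maps
   FUFU A => FU A *)
Definition FU_unit A : modHom (FU A) (FU (FU A)) :=
  @free_map (mbase A) (mbase (FU A)) A (FU A)
    (fun a => << 1 *g ucm a >>) (fun m => << 1 *g m >>).

(** The triangle identity for F. *)
Lemma counit_FU_unit A : retraction (counit (FU A)) (FU_unit A).
Proof. by apply: retraction_free => x; rewrite ?free_adj_base ?free_adj_car. Qed.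

(** The image under F of the triangle identity for U. *)
Lemma FU_counit_FU_unit A : retraction (FU_map (counit A)) (FU_unit A).
Proof.
by apply: retraction_free => x; rewrite ?free_adj_base ?free_adj_car
  ?free_adj_base ?free_adj_car.
Qed.

Variable G : topologicalGroupType.
Variable S : set (openSubgroup G).

Lemma tens_map_comm A B B' C (phi : modHom B C) (psi : modHom A B)
    (phi' : modHom B' C) (psi' : modHom A B') (X : choiceType) (t : tens A X) :
  comm_square phi psi phi' psi' ->
  tens_map phi (tens_map psi t) = tens_map phi' (tens_map psi' t).
Proof.
move=> [Eb Ec]; elim/tens_ind: t => [|t u tE uE|c m].
- by rewrite !tens_map0.
- by rewrite !tens_mapD tE uE.
rewrite !tens_mapZ Eb !tens_map_pure; congr (_ *: tpure _).
by apply/funext => x /=.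
Qed.

Lemma tens_map_retraction A B (phi : modHom B A) (psi : modHom A B)
    (X : choiceType) (t : tens A X) :
  retraction phi psi -> tens_map phi (tens_map psi t) = t.
Proof.
move=> [Eb Ec]; elim/tens_ind: t => [|t u tE uE|c m].
- by rewrite !tens_map0.
- by rewrite !tens_mapD tE uE.
rewrite !tens_mapZ Eb !tens_map_pure; congr (_ *: tpure _).
by apply/funext => x /=.
Qed.

Lemma tprod_map_comm A B B' C (phi : modHom B C) (psi : modHom A B)
    (phi' : modHom B' C) (psi' : modHom A B') (x : tprod S A) :
  comm_square phi psi phi' psi' ->
  tprod_map phi (tprod_map psi x) = tprod_map phi' (tprod_map psi' x).
Proof.
by move=> E; apply: functional_extensionality_dep => U; apply: tens_map_comm.
Qed.

Lemma tprod_map_retraction A B (phi : modHom B A) (psi : modHom A B) (x : tprod S A) :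
  retraction phi psi -> tprod_map phi (tprod_map psi x) = x.
Proof.
by move=> E; apply: functional_extensionality_dep => U; apply: tens_map_retraction.
Qed.

End FreeMaps.

(** * Descent to Witt vectors *)

Section ClosedSpan.
Variable G : topologicalGroupType.
Implicit Types (A B : modObj) (S : set (openSubgroup G)).

Lemma zspan_closed_span S A (D : set (tprod S A)) x : x \in zspan D -> closed_span D x.
Proof. by move=> Dx; apply: subset_closure. Qed.

Lemma closed_span0 S A (D : set (tprod S A)) : closed_span D 0.
Proof. by apply: zspan_closed_span; apply: rpred0. Qed.

Lemma closed_spanD S A (D : set (tprod S A)) x y :
  closed_span D x -> closed_span D y -> closed_span D (x + y).
Proof.
move=> Dx Dy; rewrite -[y]opprK -[- y]sub0r; apply: closed_spanB => //.
by apply: closed_spanB => //; apply: closed_span0.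
Qed.

Lemma closed_span_morph S S' A B (D : set (tprod S A)) (D' : set (tprod S' B))
    (f : tprod S A -> tprod S' B) x :
  {morph f : x y / x + y} -> continuous f ->
  (forall d, D d -> f d \in zspan D') ->
  closed_span D x -> closed_span D' (f x).
Proof.
move=> fD fc fDD' Dx N /(fc x) Nx.
have [z [Dz Nz]] := Dx _ Nx; exists (f z); split=> //=.
exact: zspan_morph Dz.
Qed.

(** The zero subgroup is closed because every component is discrete. *)
Lemma closed_span_set0 S A (x : tprod S A) : closed_span set0 x -> x = 0.
Proof.
move=> x0; apply: functional_extensionality_dep => U.
have [z [/= /asboolP z0 <-]] := x0 _ (tprod_nbhs_coord x U).
have /eqP -> // : z == 0.
apply: (z0 (fun z => z == 0)) => //; split=> [|y y']; first exact: eqxx.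
by rewrite !unfold_in => /eqP -> /eqP ->; rewrite subrr.
Qed.

End ClosedSpan.

Section WittTheory.
Variable G : topologicalGroupType.
Hypothesis cG : compact [set: G].

Section OneGroup.
Variables (H : openSubgroup G) (S : set (openSubgroup G)).
Hypothesis hS : truncation_set H S.
Variable ch : ghostChoice H S.
Implicit Types A B : modObj.

Lemma free_wittP A (x : tprod S A) : x \in @free_witt _ _ _ ch A <-> locspan H setT x.
Proof.
by rewrite free_wittE //; split=> [/set_mem //|xL]; apply: mem_set.
Qed.

Lemma free_wittD A (x y : tprod S A) : x \in @free_witt _ _ _ ch A ->
  y \in @free_witt _ _ _ ch A -> x + y \in @free_witt _ _ _ ch A.
Proof. by rewrite !free_wittP; apply: locspanD. Qed.

Lemma free_witt_map A B (phi : modHom A B) (x : tprod S A) :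
  x \in @free_witt _ _ _ ch A -> tprod_map phi x \in @free_witt _ _ _ ch B.
Proof. by rewrite !free_wittP; apply: tprod_map_locspan. Qed.

Lemma witt_piP A (x y : @free_witt _ _ _ ch (FU A)) :
  \pi_(witt ch A) x = \pi_(witt ch A) y <->
  closed_span (@witt_diff _ _ _ ch A) (set_val x - set_val y).
Proof.
by split=> [/eqmodP/asboolP|E]; last apply/eqmodP/asboolP.
Qed.

Lemma witt_repr A (x : @free_witt _ _ _ ch (FU A)) :
  closed_span (@witt_diff _ _ _ ch A)
    (set_val (repr (\pi_(witt ch A) x)) - set_val x).
Proof. by apply/witt_piP; rewrite reprK. Qed.

Lemma counit_witt_diff A (d : tprod S (FU A)) : @witt_diff _ _ _ ch A d ->
  tprod_map (counit A) d = 0.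
Proof.
move=> [z _ <-]; rewrite tprod_mapB; apply/eqP; rewrite subr_eq0; apply/eqP.
exact: (esym (tprod_map_comm z (counit_nat (counit A)))).
Qed.

(** The counit kills the differences, hence by continuity their closure, so the representative does
    not matter. *)
Lemma ghost_pi A (x : @free_witt _ _ _ ch (FU A)) :
  ghost (\pi_(witt ch A) x) = tprod_map (counit A) (set_val x).
Proof.
apply/eqP; rewrite -subr_eq0; apply/eqP; rewrite /ghost -tprod_mapB.
apply: closed_span_set0.
apply: (closed_span_morph (f := tprod_map (counit A)) _ _ _ (witt_repr (x := x))).
- exact: tprod_mapD.
- exact: tprod_map_continuous.
- by move=> d /counit_witt_diff ->; apply: rpred0.
Qed.

Lemma witt_add_pi A (x y z : @free_witt _ _ _ ch (FU A)) :
  set_val z = set_val x + set_val y ->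
  witt_add (\pi_(witt ch A) x) (\pi_(witt ch A) y) = \pi_(witt ch A) z.
Proof.
move=> zE; apply/witt_piP; set x' := repr _; set y' := repr _.
have -> : set_val (insubd x' (set_val x' + set_val y')) = set_val x' + set_val y'.
  by apply: insubdK; apply: free_wittD; apply: valP.
rewrite zE opprD addrACA; apply: closed_spanD; exact: witt_repr.
Qed.

(** With s = [FU_unit A] and e the counit, s e z - z is a defining difference for every z. If e x =
    e y, subtracting two of these shows that x - y is in the span, before taking closures. *)
Lemma ghost_inj A : injective (@ghost _ _ _ ch (FU A)).
Proof.
move=> x y; rewrite -[x]reprK -[y]reprK !ghost_pi => E; apply/witt_piP.
move: E (valP (repr x)) (valP (repr y)); rewrite -!set_valE.
move: (set_val (repr x)) (set_val (repr y)) => {x y} x y E Wx Wy.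
apply: zspan_closed_span.
have D z : z \in @free_witt _ _ _ ch (FU (FU A)) ->
    tprod_map (FU_unit A) (tprod_map (counit (FU A)) z) - z \in
    zspan (@witt_diff _ _ _ ch (FU A)).
  move=> Wz; apply: mem_zspan.
  (* Naturality of the counit evaluates the first map at this witness to s e z, the triangle
     identity evaluates the second to z. *)
  exists (tprod_map (FU_map (FU_unit A)) z).
    by apply: set_mem; apply: free_witt_map.
  exact: (congr2 (fun a b => a - b) (tprod_map_comm z (counit_nat (FU_unit A)))
    (tprod_map_retraction z (FU_map_retraction (counit_FU_unit A)))).
have := rpredB (D _ Wy) (D _ Wx).
by rewrite E opprB addrC addrA subrK.
Qed.

Lemma witt_diff_map A B (phi : modHom A B) d : @witt_diff _ _ _ ch A d ->
  @witt_diff _ _ _ ch B (tprod_map (FU_map phi) d).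
Proof.
move=> [z Wz <-]; exists (tprod_map (FU_map (FU_map phi)) z).
  by apply: set_mem; apply: free_witt_map; apply: mem_set.
apply/esym; apply: (etrans (tprod_mapB _ _ _)); apply/esym.
exact: (congr2 (fun a b => a - b) (tprod_map_comm z (counit_nat (FU_map phi)))
  (tprod_map_comm z (FU_map_comm (counit_nat phi)))).
Qed.

End OneGroup.

Section Descent.
Variables (H K : openSubgroup G) (S S' : set (openSubgroup G)).
Variables (cH : ghostChoice H S) (cK : ghostChoice K S') (A B : modObj).
Variable F : tprod S' (FU A) -> tprod S (FU B).
Hypothesis FD : {morph F : x y / x + y}.
Hypothesis Fc : continuous F.
Hypothesis Fw : forall x, x \in @free_witt _ _ _ cK (FU A) ->
  F x \in @free_witt _ _ _ cH (FU B).
Hypothesis Fd : forall d, @witt_diff _ _ _ cK A d -> @witt_diff _ _ _ cH B (F d).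

Variable y0 : @free_witt _ _ _ cH (FU B).

(** Covers both the functoriality maps [witt_map] and the Verschiebung. *)
Definition descend (x : witt cK A) : witt cH B :=
  \pi_(witt cH B) (insubd y0 (F (set_val (repr x)))).

Lemma descend_val (x : @free_witt _ _ _ cK (FU A)) :
  set_val (insubd y0 (F (set_val x))) = F (set_val x).
Proof. by apply: insubdK; apply: Fw; apply: valP. Qed.

Lemma descend_pi (x : @free_witt _ _ _ cK (FU A)) :
  descend (\pi_(witt cK A) x) = \pi_(witt cH B) (insubd y0 (F (set_val x))).
Proof.
apply/witt_piP; rewrite !descend_val -(morphB FD).
apply: (closed_span_morph (f := F) _ _ _ (witt_repr (x := x))) => //.
by move=> d /Fd Dd; apply: mem_zspan.
Qed.

Lemma descend_continuous : continuous descend.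
Proof.
apply/quotient_continuous.
have -> : descend \o \pi_(witt cK A) =
    \pi_(witt cH B) \o (fun x => insubd y0 (F (set_val x))).
  by apply/funext => x; apply: descend_pi.
move=> x; apply: continuous_comp; last exact: pi_continuous.
(* im(w) carries the subspace topology, so continuity into it is tested in the product. *)
move: x; apply: continuous_comp_initial.
have E : (fun x : @free_witt _ _ _ cK (FU A) => set_val (insubd y0 (F (set_val x)))) =
    (fun x => F (set_val x)).
  by apply: functional_extensionality_dep => x; apply: descend_val.
suff : continuous (fun x : @free_witt _ _ _ cK (FU A) => F (set_val x)) by rewrite -E.
move=> x; apply: continuous_comp; last exact: Fc.
exact: initial_continuous.
Qed.

End Descent.
End WittTheory.

Section WittMaps.
Variable G : topologicalGroupType.
Hypothesis cG : compact [set: G].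
Variables (H : openSubgroup G) (S : set (openSubgroup G)).
Hypothesis hS : truncation_set H S.
Variable ch : ghostChoice H S.
Implicit Types A B : modObj.

Definition free_witt_zero A : @free_witt _ _ _ ch (FU A) :=
  exist (fun y => y \in @free_witt _ _ _ ch (FU A)) _ (free_witt0 ch (FU A)).

Lemma witt_map_pi A B (phi : modHom A B) (x : @free_witt _ _ _ ch (FU A)) :
  witt_map phi (\pi_(witt ch A) x) =
  \pi_(witt ch B) (insubd (free_witt_zero B) (tprod_map (FU_map phi) (set_val x))).
Proof.
apply: (@descend_pi G _ _ _ _ ch ch A B (tprod_map (FU_map phi))).
- exact: tprod_mapD.
- exact: tprod_map_continuous.
- by move=> y; apply: free_witt_map.
- by move=> d; apply: witt_diff_map.
Qed.

Lemma witt_map_val A B (phi : modHom A B) (x : @free_witt _ _ _ ch (FU A)) :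
  set_val (insubd (free_witt_zero B) (tprod_map (FU_map phi) (set_val x))) =
  tprod_map (FU_map phi) (set_val x).
Proof. by apply: insubdK; apply: free_witt_map => //; apply: valP. Qed.

(** A preimage is the class of [FU_unit A] applied to a representative. *)
Lemma witt_map_counit_surj A (x : witt ch A) :
  exists y, witt_map (counit A) y = x.
Proof.
have Wx := free_witt_map cG hS (FU_unit A) (valP (repr x)).
pose y : @free_witt _ _ _ ch (FU (FU A)) :=
  exist (fun y => y \in @free_witt _ _ _ ch (FU (FU A))) _ Wx.
exists (\pi_(witt ch (FU A)) y); rewrite witt_map_pi -[RHS]reprK.
congr (\pi_(witt ch A) _); apply: val_inj; rewrite -set_valE witt_map_val.
exact: (tprod_map_retraction _ (FU_counit_FU_unit A)).
Qed.

End WittMaps.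

Theorem proposition3p35 (G : topologicalGroupType) (hG : profinite G)
    (H K : openSubgroup G) (hKH : K `<=` H)
    (S : set (openSubgroup G)) (hS : truncation_set H S)
    (cH : ghostChoice H S) (cK : ghostChoice K (restr_trunc S K)) :
  exists! V : forall A : modObj, witt cK A -> witt cH A,
    witt_nat V /\
    forall (A : modObj) (x : witt cK A),
      ghost (V A x) = ghost_verschiebung H K (ghost x).
Proof.
have [cG _ _] := hG; have hK := restr_truncP hKH hS.
pose ver A : tprod (restr_trunc S K) A -> tprod S A := ghost_verschiebung H K.
have ver_free A (x : tprod (restr_trunc S K) A) :
    x \in @free_witt _ _ _ cK A -> ver A x \in @free_witt _ _ _ cH A.
  rewrite (free_wittP cG hK) (free_wittP cG hS).
  exact: (ver_locspan cG hKH hS).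
have ver_diff A d : @witt_diff _ _ _ cK A d -> @witt_diff _ _ _ cH A (ver _ d).
  (* The transfer commutes with both maps from FUFU A, so the difference at z goes to the difference
     at its transfer. *)
  move=> [z Wz <-]; exists (ver _ z).
    by apply: set_mem; apply: ver_free; apply: mem_set.
  have verB := morphB (f := ver (FU A)) (fun x y => verD cG H x y).
  apply: (etrans _ (esym (verB (tprod_map (counit (FU A)) z)
    (tprod_map (FU_map (counit A)) z)))).
  exact: (congr2 (fun a b => a - b) (esym (ver_map cG H (counit (FU A)) z))
    (esym (ver_map cG H (FU_map (counit A)) z))).
pose V A : witt cK A -> witt cH A := descend (ver (FU A)) (free_witt_zero cH A).
have V_pi A x : V A (\pi_(witt cK A) x) =
    \pi_(witt cH A) (insubd (free_witt_zero cH A) (ver _ (set_val x))).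
  apply: (descend_pi (F := ver (FU A))).
  - exact: (verD cG H).
  - exact: ver_continuous.
  - exact: ver_free.
  - exact: ver_diff.
have V_val A (x : @free_witt _ _ _ cK (FU A)) :
    set_val (insubd (free_witt_zero cH A) (ver _ (set_val x))) = ver _ (set_val x).
  by apply: (descend_val (F := ver (FU A))); apply: ver_free.
have V_ghost A x : ghost (V A x) = ghost_verschiebung H K (ghost x).
  rewrite -[x]reprK V_pi !ghost_pi // V_val.
  exact: (esym (ver_map cG H (counit A) _)).
have V_nat A B (phi : modHom A B) x : V B (witt_map phi x) = witt_map phi (V A x).
  rewrite -[x]reprK (witt_map_pi cG hK) !V_pi (witt_map_pi cG hS).
  congr (\pi_(witt cH B) _); apply: val_inj; rewrite -!set_valE.
  rewrite V_val (witt_map_val cG hK) (witt_map_val cG hS) V_val.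
  exact: (ver_map cG H (FU_map phi) _).
exists V; split; first split=> //; first split=> //.
- move=> A; apply: (descend_continuous (F := ver (FU A))).
  + exact: (verD cG H).
  + exact: ver_continuous.
  + exact: ver_free.
  + exact: ver_diff.
- move=> A x y; rewrite -[x]reprK -[y]reprK.
  have Wxy := free_wittD cG hK (valP (repr x)) (valP (repr y)).
  pose z : @free_witt _ _ _ cK (FU A) :=
    exist (fun z => z \in @free_witt _ _ _ cK (FU A)) _ Wxy.
  rewrite (witt_add_pi cG hK (z := z)) // !V_pi.
  apply/esym; apply: (witt_add_pi cG hS).
  apply: (etrans (V_val _ z)); apply: (etrans (verD cG H _ _)); apply/esym.
  exact: (congr2 +%R (V_val _ (repr x)) (V_val _ (repr y))).
move=> V' [[_ _ V'nat] V'ghost].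
apply: functional_extensionality_dep => A; apply/funext => x.
(* Naturality along the counit moves the comparison to FU A, where ghost components determine the
   element. *)
have [y <-] := witt_map_counit_surj cG hK x.
rewrite V'nat V_nat; congr (witt_map _ _).
by apply: (ghost_inj cG hS); rewrite V_ghost V'ghost.
Qed.
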